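(* Let $n\ge 2$, let $\theta$ be a real antisymmetric $n\times n$ matrix, let $h=(h_{ij})\in\mathrm{GL}_n^+(\mathcal{A}_\theta)$ with inverse $h^{-1}=(h^{ij})$, let $\nu\in\mathcal{A}_\theta^{++}$, and let $\delta:\Omega^1_\theta\to\mathcal{A}_\theta$ be the divergence operator associated with $(h,\nu)$. Then: (1) The operator $-\delta$ is the formal adjoint of the differential $d:\mathcal{A}_\theta\to\Omega_\theta^1$ with respect to the inner products $\langle\cdot|\cdot\rangle_\nu^{\mathrm o}$ and $\langle\cdot|\cdot\rangle_{h,\nu}^{\mathrm o}$. That is, $$\langle-\delta\omega\,|\,u\rangle_\nu^{\mathrm o}=\langle\omega\,|\,du\rangle_{h,\nu}^{\mathrm o}\qquad\text{for all }\omega\in\Omega^1_\theta\text{ and }u\in\mathcal{A}_\theta.$$ (2) For all $\omega=\sum_i\theta^i\omega_i$ in $\Omega^1_\theta$, we have $$\delta\omega=\big[\mathrm{div}_\nu(X_\omega^{h,\nu})\big]^*,\qquad\text{where }X_\omega^{h,\nu}=\sum_{1\le i,j\le n}\omega_j^*\,\nu^{\frac12}h^{ji}\nu^{-\frac12}\,\partial_i.$$ In particular, $\delta\omega=[\mathrm{div}_\nu(X_\omega^h)]^*$ when $[h,\nu]=0$ (i.e., $\nu$ commutes with all the entries of $h$).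
   Context: Noncommutative torus. Let $n\ge2$ and let $\theta=(\theta_{jk})$ be a real antisymmetric $n\times n$ matrix with columns $\theta_1,\dots,\theta_n$. On $L^2(\mathbb{T}^n)$, $\mathbb{T}^n=\mathbb{R}^n/(2\pi\mathbb{Z})^n$, with inner product $\langle\xi|\eta\rangle=(2\pi)^{-n}\int_{\mathbb{T}^n}\xi\bar\eta\,dx$, let $(U_j\xi)(x)=e^{ix_j}\xi(x+\pi\theta_j)$ (unitary). $A_\theta$ is the $C^*$-algebra generated by $U_1,\dots,U_n$. Put $(V_s\xi)(x)=\xi(x+s)$ and $\alpha_s(T)=V_sTV_s^{-1}$ for $s\in\mathbb{R}^n$. The smooth noncommutative torus is $\mathcal{A}_\theta=\{u\in A_\theta:\ s\mapsto\alpha_s(u)\in C^\infty(\mathbb{R}^n;A_\theta)\}$, with commuting derivations $\partial_j(u)=\partial_{s_j}\alpha_s(u)|_{s=0}$. $\tau(T)=\langle T1|1\rangle$ restricts to a tracial state on $A_\theta$. $\mathcal{A}_\theta$ and all $M_m(\mathcal{A}_\theta)$ are closed under holomorphic functional calculus. $\mathcal{A}_\theta^{++}$ is the set of positive invertible elements of $\mathcal{A}_\theta$; $\mathrm{GL}_n^+(\mathcal{A}_\theta)$ is the set of positive invertible elements of $M_n(\mathcal{A}_\theta)$ (positivity in $M_n(A_\theta)$). Vector fields and forms. $\mathcal{X}_\theta$ is the free left $\mathcal{A}_\theta$-module generated by $\partial_1,\dots,\partial_n$, with Hermitian metric $(X,Y)_h=\sum_{i,j}X^ih_{ij}(Y^j)^*$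 for $X=\sum X^i\partial_i$, $Y=\sum Y^i\partial_i$. $\Omega^1_\theta=\mathrm{Hom}_{\mathcal{A}_\theta}(\mathcal{X}_\theta,\mathcal{A}_\theta)$ is a free right $\mathcal{A}_\theta$-module with dual basis $\theta^1,\dots,\theta^n$, $\langle\theta^i,\partial_j\rangle=\delta_{ij}$; every $\omega\in\Omega^1_\theta$ is uniquely $\sum_i\theta^i\omega_i$, $\omega_i\in\mathcal{A}_\theta$. The differential is $du=\sum_i\theta^i\partial_i(u)$. For $\omega\in\Omega^1_\theta$, $X^h_\omega\in\mathcal{X}_\theta$ is the unique vector field such that $\langle\omega,Y\rangle=(Y,X^h_\omega)_h$ for all $Y\in\mathcal{X}_\theta$. Inner products and divergences. $\langle u|v\rangle_\nu^{\mathrm o}=\tau(v^*\nu u)$ for $u,v\in\mathcal{A}_\theta$; $\langle\omega|\zeta\rangle_{h,\nu}^{\mathrm o}=\sum_{i,j}\tau[\zeta_i^*\nu^{1/2}h^{ij}\nu^{1/2}\omega_j]$ for $\omega=\sum\theta^i\omega_i$, $\zeta=\sum\theta^i\zeta_i$. For $X=\sum_iX^i\partial_i\in\mathcal{X}_\theta$, $\mathrm{div}_\nu(X)=\sum_i\partial_i(X^i\nu)\nu^{-1}$. The divergence operator is $\delta\omega=\nu^{-1}\sum_{i,j}\partial_i(\nu^{1/2}h^{ij}\nu^{1/2}\omega_j)$. *)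

(* Defs.v *)
From HB Require Import structures.
From mathcomp Require Import all_boot all_order all_algebra.
From mathcomp Require Import ring_quotient.
From mathcomp Require Import all_classical all_reals all_analysis.
From mathcomp Require Import complex.
Import Order.TTheory GRing.Theory Num.Theory.
Import numFieldNormedType.Exports.

Set Implicit Arguments.
Unset Strict Implicit.
Unset Printing Implicit Defensive.

Local Open Scope classical_set_scope.
Local Open Scope ring_scope.
Local Open Scope complex_scope.
Local Open Scope quotient_scope.

Section TorusMeasure.
Variable R : realType.

Lemma pi2_gt0 : (0 : R) < 2 * pi.
Proof. by rewrite mulr_gt0// pi_gt0. Qed.

Definition circle_measure : probability (measurableTypeR R) R :=
  uniform_prob pi2_gt0.

Section Cons.
Variable n : nat.

Definition tcons (x : measurableTypeR R * n.-tuple (measurableTypeR R)) :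
  n.+1.-tuple (measurableTypeR R) := [tuple of x.1 :: x.2].

Lemma measurable_tcons : measurable_fun [set: _] tcons.
Proof. exact: measurable_cons. Qed.

HB.instance Definition _ := isMeasurableFun.Build _ _ _ _ tcons measurable_tcons.
End Cons.

(* The normalized measure (2 pi)^{-n} dx on [0, 2 pi]^n, as a measure on R^n. *)
Fixpoint torus_measure (n : nat) :
    probability (n.-tuple (measurableTypeR R)) R :=
  match n with
  | 0 => \d_ [tuple]
  | m.+1 => distribution (circle_measure \x torus_measure m)%E (@tcons m)
  end.

End TorusMeasure.

Section L2.
Variables (R : realType) (n : nat).
Local Notation point := (n.-tuple (measurableTypeR R)).
Local Notation mu := (torus_measure R n).

Definition translate (s : 'cV[R]_n) (x : point) : point :=
  [tuple tnth x k + s k 0 | k < n].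

(* Functions on the torus are the 2 pi-periodic functions on R^n. *)
Definition periodic (f : point -> R[i]) :=
  forall k x, f (translate (2 * pi *: delta_mx k 0) x) = f x.

Definition sq_integrable : {pred point -> R[i]} :=
  mem [set f | [/\ periodic f,
                   (fun x => complex.Re (f x)) \in Lfun mu 2%:E &
                   (fun x => complex.Im (f x)) \in Lfun mu 2%:E]].

Lemma sq_integrable_submod : submod_closed sq_integrable.
Proof.
have [L0 LZD] := @Lfun_submod_closed _ _ R mu 2%:E (lee1n 2).
split=> [|a f g]; first by rewrite inE.
rewrite !inE => -[fp fr fi] [gp gr gi]; split=> [k x||].
- by rewrite /= !fctE fp gp.
- suff -> : (fun x => complex.Re ((a *: f + g) x)) =
    complex.Re a *: (fun x => complex.Re (f x)) +
    (- complex.Im a *: (fun x => complex.Im (f x)) +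
     (fun x => complex.Re (g x))) by apply: (LZD) => //; exact: (LZD).
  apply/funext => x; rewrite !fctE.
  by case: a (f x) (g x) => [? ?] [? ?] [? ?] /=; rewrite /GRing.scale/= mulNr addrA.
- suff -> : (fun x => complex.Im ((a *: f + g) x)) =
    complex.Re a *: (fun x => complex.Im (f x)) +
    (complex.Im a *: (fun x => complex.Re (f x)) +
     (fun x => complex.Im (g x))) by apply: (LZD) => //; exact: (LZD).
  apply/funext => x; rewrite !fctE.
  by case: a (f x) (g x) => [? ?] [? ?] [? ?] /=; rewrite addrA.
Qed.

HB.instance Definition _ :=
  GRing.isSubmodClosed.Build _ _ sq_integrable sq_integrable_submod.

Record L2fun := MkL2fun {
  L2fun_val :> point -> R[i];
  _ : L2fun_val \in sq_integrable }.

HB.instance Definition _ := [isSub for L2fun_val].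
HB.instance Definition _ := [Choice of L2fun by <:].
HB.instance Definition _ := [SubChoice_isSubLmodule of L2fun by <:].

Definition null_fun : {pred L2fun} :=
  mem [set f | {ae mu, forall x, L2fun_val f x = 0}].

Lemma null_fun_submod : submod_closed null_fun.
Proof.
split=> [|a f g]; first by rewrite inE; apply/nearW => x.
rewrite !inE => f0 g0; apply: filterS2 f0 g0 => x f0 g0.
have /(congr1 (@^~ x)) := linearP (\val : L2fun -> _) a f g.
by rewrite /= !fctE f0 g0 scaler0 addr0.
Qed.

HB.instance Definition _ :=
  GRing.isSubmodClosed.Build _ _ null_fun null_fun_submod.

Definition L2 : Type := Quotient.quot null_fun.

HB.instance Definition _ := GRing.Zmodule.on L2.
HB.instance Definition _ := EqQuotient.on L2.

Definition L2_scale (a : R[i]) : L2 -> L2 :=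
  lift_op1 L2 ( *:%R a : L2fun -> L2fun).

Lemma pi_L2_scale a : {morph \pi_L2 : f / a *: f >-> L2_scale a f}.
Proof.
move=> f; unlock L2_scale; apply/eqP; rewrite -Quotient.idealrBE -scalerBr.
by rewrite rpredZ// Quotient.idealrBE reprK.
Qed.
Canonical pi_L2_scale_morph a := PiMorph1 (pi_L2_scale a).

Fact L2_scaleA a b u : L2_scale a (L2_scale b u) = L2_scale (a * b) u.
Proof. by rewrite -[u]reprK !piE scalerA. Qed.

Fact L2_scale1 : left_id 1 L2_scale.
Proof. by move=> u; rewrite -[u]reprK !piE scale1r. Qed.

Fact L2_scaleDr : right_distributive L2_scale +%R.
Proof. by move=> a u v; rewrite -[u]reprK -[v]reprK !piE scalerDr. Qed.

Fact L2_scaleDl u : {morph L2_scale^~ u : a b / a + b}.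
Proof. by move=> a b; rewrite -[u]reprK !piE scalerDl. Qed.

HB.instance Definition _ := GRing.Zmodule_isLmodule.Build R[i] L2
  L2_scaleA L2_scale1 L2_scaleDr L2_scaleDl.

End L2.

Section Hilbert.
Variables (R : realType) (n : nat).
Local Notation point := (n.-tuple (measurableTypeR R)).
Local Notation mu := (torus_measure R n).
Local Notation H := (L2 R n).

(* Operators on L2 are defined below by applying this to an expression in
   repr u: translations and multiplication by expi preserve square-integrability
   and a.e. equality of periodic functions.
   The class of f, or 0 if f is not a periodic square-integrable function. *)
Definition L2_class (f : point -> R[i]) : H := \pi_H (insubd (0 : L2fun R n) f).

Definition cintegral (f : point -> R[i]) : R[i] :=
  (\int[mu]_x complex.Re (f x)) +i* (\int[mu]_x complex.Im (f x)).

Definition inner (u v : H) : R[i] := cintegral (fun x => repr u x * (repr v x)^*).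

Definition L2norm (u : H) : R := Num.sqrt (complex.Re (inner u u)).

End Hilbert.

(* Operators on L^2(T^n) are maps L2 -> L2; sums and scalar multiples are
   pointwise, the product is \o, the unit is idfun. *)
Notation L2op R n := (L2 R n -> L2 R n).

Section Operators.
Variables (R : realType) (n : nat).
Local Notation op := (L2op R n).

Definition opnorm_le (T : op) (c : R) := forall u, L2norm (T u) <= c * L2norm u.

(* Convergence in operator norm along the filter F. *)
Definition op_cvg {I : Type} (f : I -> op) (F : set_system I) (L : op) :=
  forall e : R, 0 < e -> \forall s \near F, opnorm_le (f s - L) e.

Definition is_adjoint (T S : op) := forall u v, inner (T u) v = inner u (S v).

(* adj, opinv, derivation, opmxinv, opsqrt, form_vf select an object satisfying its
   defining property, which determines it when it exists, and default to 0. *)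
Definition adj (T : op) : op := xget 0 [set S | is_adjoint T S].

Definition is_opinv (T S : op) := T \o S = idfun /\ S \o T = idfun.

Definition opinv (T : op) : op := xget 0 [set S | is_opinv T S].

Definition expi (t : R) : R[i] := cos t +i* sin t.

Definition V (s : 'cV[R]_n) : op :=
  fun u => L2_class (fun x => repr u (translate s x)).

Definition alpha (s : 'cV[R]_n) (T : op) : op := V s \o T \o opinv (V s).

Definition is_pderiv (f : 'cV[R]_n -> op) (s : 'cV[R]_n) (j : 'I_n) (D : op) :=
  op_cvg (fun t : R => t^-1%:C *: (f (s + t *: delta_mx j 0) - f s)) 0^' D.

Definition derivation (j : 'I_n) (u : op) : op :=
  xget 0 [set D | is_pderiv (fun s => alpha s u) 0 j D].

Definition tau (T : op) : R[i] :=
  inner (T (L2_class (fun=> 1))) (L2_class (fun=> 1)).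

Definition opmx_mul (A B : 'M[op]_n) : 'M[op]_n :=
  \matrix_(i, j) \sum_k (A i k \o B k j).

Definition opmx1 : 'M[op]_n := \matrix_(i, j) if i == j then idfun else 0.

Definition is_opmxinv (A B : 'M[op]_n) :=
  opmx_mul A B = opmx1 /\ opmx_mul B A = opmx1.

Definition opmxinv (A : 'M[op]_n) : 'M[op]_n := xget 0 [set B | is_opmxinv A B].

Definition opmx_adj (A : 'M[op]_n) : 'M[op]_n := \matrix_(i, j) adj (A j i).

End Operators.

Section NCTorus.
Variables (R : realType) (n : nat) (theta : 'M[R]_n).
Local Notation op := (L2op R n).

Definition U (j : 'I_n) : op := fun u =>
  L2_class (fun x => expi (tnth x j) * repr u (translate (pi *: col j theta) x)).

(* The C*-algebra generated by the U_j: the least set of operators containing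
   them and closed under the *-algebra operations and operator-norm limits. *)
Inductive nctorus : set op :=
| nct_gen j : nctorus (U j)
| nct_add S T : nctorus S -> nctorus T -> nctorus (S + T)
| nct_scale a T : nctorus T -> nctorus (a *: T)
| nct_mul S T : nctorus S -> nctorus T -> nctorus (S \o T)
| nct_adj S T : nctorus T -> is_adjoint T S -> nctorus S
| nct_lim (f : nat -> op) T :
    (forall k, nctorus (f k)) -> op_cvg f \oo T -> nctorus T.

(* Maps R^n -> nctorus of class C^k, for the operator norm. *)
Fixpoint Ck (k : nat) (f : 'cV[R]_n -> op) : Prop :=
  [/\ forall s, nctorus (f s),
      forall s, op_cvg f (nbhs s) (f s) &
      match k with
      | 0 => True
      | l.+1 => forall j, exists2 g, forall s, is_pderiv f s j (g s) & Ck l g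
      end].

Definition smooth_nct : set op :=
  [set u | nctorus u /\ forall k, Ck k (fun s => alpha s u)].

(* Positivity in the C*-algebras nctorus and M_n(nctorus). *)
Definition positive (a : op) := exists2 b, nctorus b & a = adj b \o b.

Definition positive_mx (A : 'M[op]_n) :=
  exists2 B : 'M[op]_n, forall i j, nctorus (B i j) & A = opmx_mul (opmx_adj B) B.

Definition smooth_pos_inv : set op :=
  [set u | [/\ smooth_nct u, positive u &
               exists2 v, smooth_nct v & is_opinv u v]].

Definition GLplus : set 'M[op]_n :=
  [set A : 'M[op]_n | [/\ forall i j, smooth_nct (A i j), positive_mx A &
      exists2 B : 'M[op]_n, forall i j, smooth_nct (B i j) & is_opmxinv A B]].

Definition opsqrt (a : op) : op := xget 0 [set r | positive r /\ r \o r = a].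

(* The vector field \sum_i X^i \partial_i is the family of the X^i. *)
Definition vfield : set ('I_n -> op) := [set X | forall i, smooth_nct (X i)].

Definition vf_scale (a : op) (X : 'I_n -> op) : 'I_n -> op := fun i => a \o X i.

Definition vf_basis (j : 'I_n) : 'I_n -> op :=
  fun i => if i == j then idfun else 0.

Definition metric (h : 'M[op]_n) (X Y : 'I_n -> op) : op :=
  \sum_i \sum_j (X i \o h i j \o adj (Y j)).

(* Left module homomorphisms vfield -> smooth_nct; values outside vfield are
   irrelevant. *)
Definition form1 : set (('I_n -> op) -> op) :=
  [set w | [/\ forall X, vfield X -> smooth_nct (w X),
      forall X Y, vfield X -> vfield Y -> w (X + Y) = w X + w Y &
      forall a X, smooth_nct a -> vfield X -> w (vf_scale a X) = a \o w X]].

Definition dual_basis (i : 'I_n) : ('I_n -> op) -> op := fun X => X i.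

Definition form_mul (w : ('I_n -> op) -> op) (a : op) : ('I_n -> op) -> op :=
  fun X => w X \o a.

Definition coef (w : ('I_n -> op) -> op) (i : 'I_n) : op := w (vf_basis i).

Definition d (u : op) : ('I_n -> op) -> op :=
  \sum_i form_mul (dual_basis i) (derivation i u).

Definition form_vf (h : 'M[op]_n) (w : ('I_n -> op) -> op) : 'I_n -> op :=
  xget 0 [set X | vfield X /\ forall Y, vfield Y -> w Y = metric h Y X].

Definition inner_nu (nu u v : op) : R[i] := tau (adj v \o nu \o u).

Definition inner_form (h : 'M[op]_n) (nu : op) (w z : ('I_n -> op) -> op) : R[i] :=
  \sum_i \sum_j tau (adj (coef z i) \o opsqrt nu \o opmxinv h i j \o
                     opsqrt nu \o coef w j).

Definition div (nu : op) (X : 'I_n -> op) : op :=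
  \sum_i (derivation i (X i \o nu) \o opinv nu).

Definition delta (h : 'M[op]_n) (nu : op) (w : ('I_n -> op) -> op) : op :=
  opinv nu \o
  \sum_i \sum_j derivation i (opsqrt nu \o opmxinv h i j \o opsqrt nu \o coef w j).

Definition form_vf_nu (h : 'M[op]_n) (nu : op) (w : ('I_n -> op) -> op) :
    'I_n -> op :=
  fun i => \sum_j (adj (coef w j) \o opsqrt nu \o opmxinv h j i \o
                   opinv (opsqrt nu)).

End NCTorus.

(* Main.v *)
From HB Require Import structures.
Require Import Defs.
From mathcomp Require Import all_boot all_order all_algebra.
From mathcomp Require Import all_classical all_reals all_analysis.
From mathcomp Require Import measurable_realfun.
From mathcomp Require Import complex ring lra.
Import Order.TTheory GRing.Theory Num.Theory.
Import numFieldNormedType.Exports.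

(** The translations [alpha s] are implemented by unitaries that fix the constant
    function 1, so the trace [tau] is invariant under them and vanishes on every
    derivative. With the Leibniz rule this is integration by parts
    ([tau_by_parts]), and applying it to the adjoint of u and to the terms
    nu^{1/2} h^{ij} nu^{1/2} omega_j gives the duality between d and - delta.
    The formulas for delta in terms of the divergence of a vector field come from
    taking adjoints of these terms, because adjunction commutes with the
    derivations, nu and nu^{1/2} are self-adjoint, and the adjoint of h^{ij} is
    h^{ji} ([delta_div]). The vector field dual to omega is found by inverting h
    ([form_vfE]); if nu commutes with the entries of h, then nu^{1/2} commutes
    with those of the inverse, and the two vector fields have the same divergence.

    Two analytic facts make these computations legitimate. The first is that all
    elements of the noncommutative torus are bounded and have adjoints. For the
    generators, which are weighted translations, this is the translation invariance
    of the torus measure; it passes to norm limits because L2 is complete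
    ([adjointable_lim]). The second concerns nu^{1/2}: it exists in the algebra,
    it is differentiable along the translation action, and it commutes with
    whatever commutes with nu. A positive invertible element has the form
    rho (1 - y) with y of norm less than 1 ([near_scalar_positive]). Hence square
    roots are fixed points of a contraction ([sqrt_exists]), and for such an r the
    Sylvester equation r X + X r = Y has exactly one solution, bounded by a
    multiple of the norm of Y ([sylvester_exists], [sylvester_bound]). The
    commutator of nu^{1/2} with an operator commuting with nu solves the equation
    with right-hand side 0, and the derivative of nu^{1/2} solves it with the
    derivative of nu on the right. Since delta takes first derivatives at 0, this
    is the regularity of nu^{1/2} that the theorem rests on. *)

Set Implicit Arguments.
Unset Strict Implicit.
Unset Printing Implicit Defensive.

Local Open Scope classical_set_scope.
Local Open Scope ring_scope.

(** * Translation invariance of the torus measure *)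

Section LebesgueTranslation.
Variable R : realType.
Local Notation leb := (@lebesgue_measure R).
Local Open Scope ereal_scope.

Let shiftr (s : R) : measurableTypeR R -> measurableTypeR R := fun x => (x + s)%R.

Let measurable_shiftr s : measurable_fun setT (shiftr s).
Proof. by apply: measurable_funD. Qed.

#[local] HB.instance Definition _ s := isMeasurableFun.Build _ _ _ _ (shiftr s) (measurable_shiftr s).

Let preimage_shiftr s (x y : R) (c d : bool) :
  shiftr s @^-1` [set` Interval (BSide c x) (BSide d y)] =
  [set` Interval (BSide c (x - s)%R) (BSide d (y - s)%R)].
Proof.
apply/seteqP; split => z /=; rewrite !in_itv/= /shiftr;
  by case: c d => -[]; rewrite /= ?lerBlDr ?ltrBlDr ?lerBrDr ?ltrBrDr.
Qed.

Lemma lebesgue_measure_shift (s : R) (A : set (measurableTypeR R)) : measurable A ->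
  pushforward leb (fun x : measurableTypeR R => (x + s)%R : measurableTypeR R) A = leb A.
Proof.
move=> mA; apply/esym.
apply: (@lebesgue_measure_unique _ (pushforward leb (shiftr s))) => //= _ [[a b]] _ <-.
rewrite /pushforward preimage_shiftr//= !lebesgue_measure_itv/=.
rewrite !lte_fin ltrD2r; case: ifPn => // _.
by rewrite -!EFinD; congr EFin; ring.
Qed.

Lemma ge0_integral_shift (f : R -> \bar R) (s x y : R) (c d : bool) :
  measurable_fun [set: R] f -> (forall r, 0 <= f r) ->
  \int[leb]_(r in [set` Interval (BSide c x) (BSide d y)]) f (r + s)%R =
  \int[leb]_(r in [set` Interval (BSide c (x + s)%R) (BSide d (y + s)%R)]) f r.
Proof.
move=> mf f0.
rewrite (_ : [set` Interval (BSide c x) (BSide d y)] =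
   shiftr s @^-1` [set` Interval (BSide c (x + s)%R) (BSide d (y + s)%R)]); last first.
  by rewrite preimage_shiftr// !addrK.
rewrite -(@ge0_integral_pushforward _ _ _ _ _ (shiftr s))//=; last exact: measurable_funS mf.
apply: eq_measure_integral => //= A mA AS; exact: lebesgue_measure_shift.
Qed.

Let integral_itv_split (f : R -> \bar R) (a b c : R) : (a <= b <= c)%R ->
  measurable_fun [set: R] f -> (forall r, 0 <= f r) ->
  \int[leb]_(r in `[a, c[) f r = \int[leb]_(r in `[a, b[) f r + \int[leb]_(r in `[b, c[) f r.
Proof.
move=> /andP[ab bc] mf f0.
rewrite -ge0_integral_setU//=.
- by rewrite -itv_bndbnd_setU// bnd_simp.
- exact: measurable_funS mf.
- apply/disj_setPS => x /= []; rewrite !in_itv/= => /andP[_ xb] /andP[bx _].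
  by move: (lt_le_trans xb bx); rewrite ltxx.
Qed.

(** Only the remainder t of s modulo p matters. For 0 <= t < p the shifted window
    [t, p + t[ is [t, p[ followed by [p, p + t[, which periodicity brings back
    to [0, t[. *)
Lemma ge0_integral_period (f : R -> \bar R) (p s : R) : (0 < p)%R ->
  measurable_fun [set: R] f -> (forall r, 0 <= f r) -> (forall r, f (r + p)%R = f r) ->
  \int[leb]_(r in `[0%R, p]) f (r + s)%R = \int[leb]_(r in `[0%R, p]) f r.
Proof.
move=> p0 mf f0 fp.
have mfs (t : R) : measurable_fun [set: R] (fun r : R => f (r + t)%R).
  by apply: (measurableT_comp mf); exact: measurable_shiftr.
rewrite -!integral_itv_bndo_bndc//=; [|exact: measurable_funS mf|exact: measurable_funS (mfs s)].
have fpn (k : nat) r : f (r + p *+ k)%R = f r.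
  by elim: k r => [|k IH] r; rewrite ?mulr0n ?addr0// mulrS addrA IH fp.
have fpz (k : int) r : f (r + p *~ k)%R = f r.
  case: k => j; first by rewrite -pmulrn fpn.
  by rewrite NegzE mulrNz -[in RHS](addrNK (p *~ j.+1) r) -pmulrn fpn.
have small (t : R) : (0 <= t < p)%R ->
    \int[leb]_(r in `[0%R, p[) f (r + t)%R = \int[leb]_(r in `[0%R, p[) f r.
  move=> /andP[t0 tp]; rewrite (ge0_integral_shift _ 0%R p)// add0r.
  rewrite (@integral_itv_split f t p (p + t)) ?(ltW tp) ?lerDl ?t0//.
  rewrite (@integral_itv_split f 0 t p) ?t0 ?ltW// addeC; congr (_ + _).
  have := @ge0_integral_shift f p 0%R t true true mf f0.
  rewrite add0r (addrC t) => <-; apply: eq_integral => r _; exact: fp.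
pose k := Num.floor (s / p).
pose t := (s - p *~ k)%R.
have tp : (0 <= t < p)%R.
  have /andP[] := Num.Theory.floor_itv (s / p).
  rewrite intrD1 ler_pdivlMr// ltr_pdivrMr// /t -mulrzr -/k => h1 h2.
  by apply/andP; split; lra.
rewrite -(small t)//; apply: eq_integral => r _.
have -> : (r + s = (r + t) + p *~ k)%R by rewrite /t; ring.
exact: fpz.
Qed.

End LebesgueTranslation.

Section TorusTranslation.
Variable R : realType.
Local Open Scope ereal_scope.
Local Notation mu n := (torus_measure R n).

Lemma ge0_integral_circle_translate (f : R -> \bar R) (s : R) :
  measurable_fun [set: R] f -> (forall r, 0 <= f r) ->
  (forall r, f (r + 2 * pi)%R = f r) ->
  \int[@circle_measure R]_r f (r + s)%R = \int[@circle_measure R]_r f r.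
Proof.
move=> mf f0 fp.
have mfs : measurable_fun [set: R] (fun r : R => f (r + s)%R).
  by apply: (measurableT_comp mf); apply: measurable_funD.
rewrite /circle_measure !integral_uniform//; congr (_ * _).
exact: (ge0_integral_period _ (@pi2_gt0 R)).
Qed.

Lemma measurable_translate n (s : 'cV[R]_n) :
  measurable_fun [set: n.-tuple (measurableTypeR R)] (translate s).
Proof.
apply/measurable_fun_tnthP => i.
rewrite (_ : _ \o _ = (fun x => tnth x i + s i ord0)%R); last first.
  by apply/funext => x /=; rewrite tnth_mktuple.
by apply: measurable_funD => //; exact: measurable_tnth.
Qed.

Lemma translate_tcons n (s : 'cV[R]_n.+1) (t : R) (x : n.-tuple (measurableTypeR R)) :
  translate s (tcons (t, x)) =
  tcons ((t + s ord0 ord0)%R : measurableTypeR R, translate (\col_i s (lift ord0 i) ord0) x).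
Proof.
apply: eq_from_tnth => i; rewrite tnth_mktuple.
by case: (unliftP ord0 i) => [j ->|->] //=; rewrite /tcons/= ?tnthS ?tnth0 // tnth_mktuple mxE.
Qed.

Lemma ge0_integral_torusS n (f : n.+1.-tuple (measurableTypeR R) -> \bar R) :
  measurable_fun [set: _] f -> (forall r, 0 <= f r) ->
  \int[mu n.+1]_x f x =
  \int[@circle_measure R]_t \int[mu n]_x f (tcons (t, x)).
Proof.
move=> mf f0; rewrite /= ge0_integral_distribution//.
rewrite fubini_tonelli1//=.
by apply: measurableT_comp => //; exact: measurable_tcons.
Qed.

(** Induction on n by Tonelli: for a fixed first coordinate the inner integral
    is invariant by the induction hypothesis, and what remains is a periodic
    function of the first coordinate. Nonnegativity is what Tonelli requires. *)
Lemma ge0_integral_torus_translate n (f : n.-tuple (measurableTypeR R) -> \bar R)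
    (s : 'cV[R]_n) :
  measurable_fun [set: _] f -> (forall r, 0 <= f r) ->
  (forall k x, f (translate (2 * pi *: delta_mx k ord0)%R x) = f x) ->
  \int[mu n]_x f (translate s x) = \int[mu n]_x f x.
Proof.
elim: n f s => [|n IH] f s mf f0 fp.
  by apply: eq_integral => x _; congr f; apply: eq_from_tnth; case.
have mfc : measurable_fun setT (f \o @tcons R n).
  by apply: measurableT_comp => //; exact: measurable_tcons.
rewrite !ge0_integral_torusS//; last first.
  by apply: (measurableT_comp mf); exact: measurable_translate.
pose s' : 'cV[R]_n := (\col_i s (lift ord0 i) ord0)%R.
transitivity (\int[@circle_measure R]_t \int[mu n]_x
    f (tcons ((t + s ord0 ord0)%R : measurableTypeR R, x))).
  apply: eq_integral => t _.
  under eq_integral do rewrite translate_tcons.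
  pose g (x : n.-tuple (measurableTypeR R)) := f (tcons ((t + s ord0 ord0)%R : measurableTypeR R, x)).
  apply: (IH g s') => [|x|k x]; rewrite /g//.
    apply: (measurableT_comp mfc); exact: measurable_pair1.
  rewrite -[RHS](fp (lift ord0 k)) translate_tcons; congr (f (tcons (_, _))).
    by rewrite !mxE /= mulr0 addr0.
  by congr (translate _ x); apply/matrixP => i j; rewrite !mxE (ord1 j) eqxx andbT.
pose G (t : R) := \int[mu n]_x f (tcons (t : measurableTypeR R, x)).
apply: (@ge0_integral_circle_translate G).
- have := @measurable_fun_fubini_tonelli_F _ _ _ _ _ (mu n) _ mfc (fun x => f0 _); apply.
- by move=> t; apply: integral_ge0.
- move=> t; apply: eq_integral => x _.
  rewrite -[RHS](fp ord0) translate_tcons; congr (f (tcons (_, _))).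
    by rewrite !mxE /= mulr1.
  apply: eq_from_tnth => i; rewrite tnth_mktuple !mxE/=.
  by rewrite mulr0 addr0.
Qed.

End TorusTranslation.

(** * The inner product of the space L2 *)

Section L2Inner.
Variables (R : realType) (n : nat).
Local Notation point := (n.-tuple (measurableTypeR R)).
Local Notation mu := (torus_measure R n).
Local Notation H := (L2 R n).
Local Notation Re := (@complex.Re R).
Local Notation Im := (@complex.Im R).
Local Open Scope complex_scope.
Local Open Scope ring_scope.
Local Open Scope quotient_scope.

Definition cintegrable (f : point -> R[i]) :=
  mu.-integrable setT (fun x => (Re (f x))%:E) /\
  mu.-integrable setT (fun x => (Im (f x))%:E).

Lemma cReD (x y : R[i]) : Re (x + y) = Re x + Re y. Proof. by case: x y => ? ? []. Qed.
Lemma cImD (x y : R[i]) : Im (x + y) = Im x + Im y. Proof. by case: x y => ? ? []. Qed.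
Lemma cReN (x : R[i]) : Re (- x) = - Re x. Proof. by case: x. Qed.
Lemma cImN (x : R[i]) : Im (- x) = - Im x. Proof. by case: x. Qed.
Lemma cReM (x y : R[i]) : Re (x * y) = Re x * Re y - Im x * Im y.
Proof. by case: x y => ? ? []. Qed.
Lemma cImM (x y : R[i]) : Im (x * y) = Re x * Im y + Im x * Re y.
Proof. by case: x y => ? ? []. Qed.
Lemma cReJ (x : R[i]) : Re (x^*) = Re x. Proof. by case: x. Qed.
Lemma cImJ (x : R[i]) : Im (x^*) = - Im x. Proof. by case: x. Qed.
Lemma complex_eq (x y : R[i]) : Re x = Re y -> Im x = Im y -> x = y.
Proof. by case: x y => ? ? [] ? ? /= -> ->. Qed.

Lemma measurable_cintegrable f : cintegrable f ->
  measurable_fun setT (fun x => Re (f x)) /\ measurable_fun setT (fun x => Im (f x)).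
Proof.
by move=> -[/measurable_int /measurable_EFinP ? /measurable_int /measurable_EFinP].
Qed.

Lemma cintegrableD f g : cintegrable f -> cintegrable g ->
  cintegrable (fun x => f x + g x).
Proof.
move=> [fr fi] [gr gi]; split.
  rewrite (_ : (fun _ => _) = (fun x => (Re (f x))%:E + (Re (g x))%:E)%E); last first.
    by apply/funext => x; rewrite cReD EFinD.
  exact: integrableD.
rewrite (_ : (fun _ => _) = (fun x => (Im (f x))%:E + (Im (g x))%:E)%E); last first.
  by apply/funext => x; rewrite cImD EFinD.
exact: integrableD.
Qed.

Lemma cintegrableZ a f : cintegrable f -> cintegrable (fun x => a * f x).
Proof.
move=> [fr fi]; split.
  rewrite (_ : (fun _ => _) = (fun x => (Re a)%:E * (Re (f x))%:E - (Im a)%:E * (Im (f x))%:E)%E).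
    by apply: integrableB => //; exact: integrableZl.
  by apply/funext => x; rewrite cReM EFinB.
rewrite (_ : (fun _ => _) = (fun x => (Re a)%:E * (Im (f x))%:E + (Im a)%:E * (Re (f x))%:E)%E).
  by apply: integrableD => //; exact: integrableZl.
by apply/funext => x; rewrite cImM EFinD.
Qed.

Lemma cintegralD f g : cintegrable f -> cintegrable g ->
  cintegral (fun x => f x + g x) = cintegral f + cintegral g.
Proof.
move=> [fr fi] [gr gi]; apply: complex_eq; rewrite /= -?RintegralD//;
  by apply: eq_Rintegral => x _; rewrite ?cReD ?cImD.
Qed.

Lemma cintegralZ a f : cintegrable f ->
  cintegral (fun x => a * f x) = a * cintegral f.
Proof.
move=> [fr fi]; apply: complex_eq.
  rewrite cReM/= -!RintegralZl// -RintegralB//; last 2 first.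
    exact: (@integrableZl _ _ _ _ _ _ (Re a) (fun x => (Re (f x))%:E)).
    exact: (@integrableZl _ _ _ _ _ _ (Im a) (fun x => (Im (f x))%:E)).
  by apply: eq_Rintegral => x _; rewrite cReM.
rewrite cImM/= -!RintegralZl// -RintegralD//; last 2 first.
  exact: (@integrableZl _ _ _ _ _ _ (Re a) (fun x => (Im (f x))%:E)).
  exact: (@integrableZl _ _ _ _ _ _ (Im a) (fun x => (Re (f x))%:E)).
by apply: eq_Rintegral => x _; rewrite cImM.
Qed.

Lemma cintegralC f : cintegrable f -> cintegral (fun x => (f x)^*) = (cintegral f)^*.
Proof.
move=> [fr fi]; apply: complex_eq; rewrite ?cReJ ?cImJ/=.
  by apply: eq_Rintegral => x _; rewrite cReJ.
rewrite -mulN1r -RintegralZl//.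
by apply: eq_Rintegral => x _; rewrite cImJ mulN1r.
Qed.

Lemma cintegral_ae f g : cintegrable f -> cintegrable g ->
  {ae mu, forall x, f x = g x} -> cintegral f = cintegral g.
Proof.
move=> /measurable_cintegrable [fr fi] /measurable_cintegrable[gr gi] fg.
apply: complex_eq; congr fine; apply: ae_eq_integral => //.
- exact/measurable_EFinP.
- exact/measurable_EFinP.
- by apply: filterS fg => x /= ->.
- exact/measurable_EFinP.
- exact/measurable_EFinP.
- by apply: filterS fg => x /= ->.
Qed.

Lemma sq_integrableP (f : point -> R[i]) : f \in @sq_integrable R n <->
  [/\ Defs.periodic f, (fun x => Re (f x)) \in Lfun mu 2%:E &
    (fun x => Im (f x)) \in Lfun mu 2%:E].
Proof. by split=> [|h]; rewrite /sq_integrable inE. Qed.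

Lemma L2fun_sq (f : L2fun R n) : (f : point -> R[i]) \in @sq_integrable R n.
Proof. by case: f. Qed.

Lemma L2funM_cintegrable (f g : L2fun R n) : cintegrable (fun x => f x * (g x)^*).
Proof.
have /sq_integrableP[_ fr fi] := L2fun_sq f.
have /sq_integrableP[_ gr gi] := L2fun_sq g.
have I a b : a \in Lfun mu 2%:E -> b \in Lfun mu 2%:E ->
    mu.-integrable setT (fun x => (a x)%:E * (b x)%:E)%E.
  by move=> ha hb; apply/Lfun1_integrable; exact: Lfun2_mul_Lfun1.
split.
  rewrite (_ : (fun _ => _) = (fun x => (Re (f x))%:E * (Re (g x))%:E + (Im (f x))%:E * (Im (g x))%:E)%E).
    by apply: integrableD => //; exact: I.
  by apply/funext => x; rewrite cReM cReJ cImJ mulrN opprK EFinD !EFinM.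
rewrite (_ : (fun _ => _) = (fun x => (Im (f x))%:E * (Re (g x))%:E - (Re (f x))%:E * (Im (g x))%:E)%E).
  by apply: integrableB => //; exact: I.
by apply/funext => x; rewrite cImM cReJ cImJ mulrN addrC EFinB !EFinM.
Qed.

Lemma pi_L2_eq (f g : L2fun R n) :
  (\pi_H f = \pi_H g) <-> {ae mu, forall x, f x = g x}.
Proof.
rewrite (rwP eqP) -Quotient.idealrBE inE/=.
split; apply: filterS => x;
  have /(congr1 (@^~ x)) := raddfB (\val : L2fun R n -> _) f g; rewrite /= => ->.
  by move/eqP; rewrite fctE/= subr_eq0 => /eqP.
by move=> e; rewrite fctE/= e subrr.
Qed.

Lemma repr_pi_ae (f : L2fun R n) : {ae mu, forall x, repr (\pi_H f) x = f x}.
Proof. by apply/pi_L2_eq; rewrite reprK. Qed.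

Lemma pi_L2_lin a (f g : L2fun R n) : \pi_H (a *: f + g) = a *: \pi_H f + \pi_H g.
Proof. by rewrite -[_ *: \pi_H f]/(L2_scale a (\pi_H f)) !piE. Qed.

(** The inner product is computed on chosen representatives, which respect the
    linear operations almost everywhere only; that is enough for integrals, and
    makes the inner product sesquilinear. *)
Lemma repr_lin a (u v : H) : {ae mu, forall x, repr (a *: u + v) x = a * repr u x + repr v x}.
Proof.
have := repr_pi_ae (a *: repr u + repr v).
rewrite pi_L2_lin !reprK; apply: filterS => x ->.
have /(congr1 (@^~ x)) := linearP (\val : L2fun R n -> _) a (repr u) (repr v).
rewrite /= => ->.
by rewrite !fctE.
Qed.

Lemma inner_cintegrable (u v : H) : cintegrable (fun x => repr u x * (repr v x)^*).
Proof. exact: L2funM_cintegrable. Qed.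

Lemma inner_pi (f g : L2fun R n) :
  inner (\pi_H f) (\pi_H g) = cintegral (fun x => f x * (g x)^*).
Proof.
apply: cintegral_ae; [exact: inner_cintegrable|exact: L2funM_cintegrable|].
by apply: filterS2 (repr_pi_ae f) (repr_pi_ae g) => x -> ->.
Qed.

Lemma innerDZl a u v (w : H) : inner (a *: u + v) w = a * inner u w + inner v w.
Proof.
rewrite /inner -cintegralZ; last exact: inner_cintegrable.
rewrite -cintegralD; [|exact/cintegrableZ/inner_cintegrable|exact: inner_cintegrable].
apply: cintegral_ae; first exact: inner_cintegrable.
  apply: cintegrableD; [exact/cintegrableZ/inner_cintegrable|exact: inner_cintegrable].
by apply: filterS (repr_lin a u v) => x ->; rewrite mulrDl mulrA.
Qed.

Lemma innerC (u v : H) : inner u v = (inner v u)^*.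
Proof.
rewrite /inner -cintegralC; last exact: inner_cintegrable.
by congr cintegral; apply/funext => x; rewrite rmorphM/= conjCK mulrC.
Qed.

Lemma inner0l (w : H) : inner 0 w = 0.
Proof. by have := innerDZl (-1) 0 0 w; rewrite scaler0 addr0 mulN1r addNr. Qed.
Lemma innerDl (u v w : H) : inner (u + v) w = inner u w + inner v w.
Proof. by have := innerDZl 1 u v w; rewrite scale1r mul1r. Qed.
Lemma innerZl a (u w : H) : inner (a *: u) w = a * inner u w.
Proof. by have := innerDZl a u 0 w; rewrite inner0l !addr0. Qed.
Lemma innerNl (u w : H) : inner (- u) w = - inner u w.
Proof. by rewrite -scaleN1r innerZl mulN1r. Qed.
Lemma innerBl (u v w : H) : inner (u - v) w = inner u w - inner v w.
Proof. by rewrite innerDl innerNl. Qed.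
Lemma inner0r (w : H) : inner w 0 = 0.
Proof. by rewrite innerC inner0l rmorph0. Qed.
Lemma innerDr (u v w : H) : inner w (u + v) = inner w u + inner w v.
Proof. by rewrite innerC innerDl rmorphD/= -!innerC. Qed.
Lemma innerZr a (u w : H) : inner w (a *: u) = a^* * inner w u.
Proof. by rewrite innerC innerZl rmorphM/= -innerC. Qed.
Lemma innerNr (u w : H) : inner w (- u) = - inner w u.
Proof. by rewrite innerC innerNl rmorphN/= -innerC. Qed.
Lemma innerBr (u v w : H) : inner w (u - v) = inner w u - inner w v.
Proof. by rewrite innerDr innerNr. Qed.

Lemma inner_selfE (u : H) :
  inner u u = (Re (inner u u))%:C.
Proof.
apply: complex_eq => //=; transitivity (\int[mu]_(x in setT) (0 : R)).
  by apply: eq_Rintegral => x _; rewrite cImM cReJ cImJ; ring.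
by rewrite Rintegral_cst// mul0r.
Qed.

Lemma Re_inner_pi (f : L2fun R n) :
  (Re (inner (\pi_H f) (\pi_H f)))%:E = (\int[mu]_x (Re (f x) ^+ 2 + Im (f x) ^+ 2)%:E)%E.
Proof.
rewrite inner_pi /= /Rintegral fineK; last first.
  by apply: integrable_fin_num => //; case: (L2funM_cintegrable f f).
by apply: eq_integral => x _; rewrite cReM cReJ cImJ mulrN opprK !expr2.
Qed.

Lemma inner_ge0 (u : H) : 0 <= Re (inner u u).
Proof.
rewrite -lee_fin -[u]reprK Re_inner_pi; apply: integral_ge0 => x _.
by rewrite lee_fin addr_ge0// sqr_ge0.
Qed.

Lemma inner_eq0 (u : H) : Re (inner u u) = 0 -> u = 0.
Proof.
move=> u0; have := Re_inner_pi (repr u); rewrite reprK u0.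
set f := repr u => int0.
have /sq_integrableP[_ /sub_Lfun_mfun mr /sub_Lfun_mfun mi] := L2fun_sq f.
move: mr mi; rewrite !inE/= => mr mi.
have : (\int[mu]_x `|(Re (f x) ^+ 2 + Im (f x) ^+ 2)%:E| = 0)%E.
  rewrite -[RHS]/(0%:E) int0; apply: eq_integral => x _; rewrite gee0_abs// lee_fin.
  by rewrite addr_ge0// sqr_ge0.
move/ae_eq_integral_abs => ae0.
rewrite -[u]reprK -[0]reprK; apply/pi_L2_eq.
have r0 : {ae mu, forall x, repr (0 : H) x = 0}.
  have := repr_pi_ae 0; rewrite (_ : \pi_H 0 = 0) ?piE//.
apply: filterS2 r0 (ae0 _ _) => // [x -> /(_ I) [] h|].
  have /andP[] : (Re (f x) ^+ 2 == 0) && (Im (f x) ^+ 2 == 0).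
    by rewrite -paddr_eq0 ?sqr_ge0// h.
  by rewrite !sqrf_eq0 => /eqP a /eqP b; apply: complex_eq.
by apply/measurable_EFinP; apply: measurable_funD; apply: measurable_funX.
Qed.

End L2Inner.

(** * The norm of L2 *)

Section L2Norm.
Variables (R : realType) (n : nat).
Local Notation point := (n.-tuple (measurableTypeR R)).
Local Notation mu := (torus_measure R n).
Local Notation H := (L2 R n).
Local Notation Re := (@complex.Re R).
Local Notation Im := (@complex.Im R).
Local Notation cabs := (@ComplexField.Normc.normc R).
Local Open Scope complex_scope.
Local Open Scope ring_scope.
Implicit Types u v w : H.

Lemma L2norm_ge0 u : 0 <= L2norm u. Proof. exact: sqrtr_ge0. Qed.

Lemma L2norm_sqr u : L2norm u ^+ 2 = Re (inner u u).
Proof. by rewrite sqr_sqrtr// inner_ge0. Qed.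

Lemma L2norm0 : L2norm (0 : H) = 0.
Proof. by rewrite /L2norm inner0l sqrtr0. Qed.

Lemma L2norm_eq0 u : L2norm u = 0 -> u = 0.
Proof. by move=> u0; apply: inner_eq0; rewrite -L2norm_sqr u0 expr0n. Qed.

Lemma L2norm_le0 u : L2norm u <= 0 -> u = 0.
Proof. by move=> u0; apply: L2norm_eq0; apply/eqP; rewrite eq_le u0 L2norm_ge0. Qed.

Lemma cabs_ge0 z : 0 <= cabs z. Proof. by case: z => a b; exact: sqrtr_ge0. Qed.

Lemma cabsC z : cabs z^* = cabs z.
Proof. by case: z => a b /=; rewrite sqrrN. Qed.

Lemma cabsR (r : R) : cabs r%:C = `|r|.
Proof. by rewrite /= expr0n/= addr0 sqrtr_sqr. Qed.

Lemma mulc_conj z : z * z^* = (cabs z ^+ 2)%:C.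
Proof.
case: z => a b; apply: complex_eq => /=; rewrite ?sqr_sqrtr ?addr_ge0 ?sqr_ge0//; ring.
Qed.

Lemma cReR (r : R) : Re r%:C = r. Proof. by []. Qed.

Lemma cReMR (r : R) z : Re ((r%:C)^* * z) = r * Re z.
Proof. by case: z => a b /=; rewrite oppr0 mul0r subr0. Qed.

Lemma L2normZ a u : L2norm (a *: u) = cabs a * L2norm u.
Proof.
rewrite /L2norm innerZl innerZr mulrA mulc_conj inner_selfE -rmorphM cReR.
by rewrite sqrtrM ?sqr_ge0// sqrtr_sqr ger0_norm// cabs_ge0.
Qed.

Lemma L2normN u : L2norm (- u) = L2norm u.
Proof. by rewrite /L2norm innerNl innerNr opprK. Qed.

Lemma L2normBC u v : L2norm (u - v) = L2norm (v - u).
Proof. by rewrite -L2normN opprB. Qed.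

Lemma Re_innerC u v : Re (inner u v) = Re (inner v u).
Proof. by rewrite innerC cReJ. Qed.

Lemma L2norm_sqrD u v : L2norm (u + v) ^+ 2 =
  L2norm u ^+ 2 + 2 * Re (inner u v) + L2norm v ^+ 2.
Proof. rewrite !L2norm_sqr innerDl !innerDr !cReD (Re_innerC v u); ring. Qed.

(** Cauchy-Schwarz for real parts: the squared norm of u - t v is nonnegative at
    its minimum, t = Re <u, v> / |v|^2. *)
Lemma Re_inner_le u v : Re (inner u v) <= L2norm u * L2norm v.
Proof.
have [v0|v0] := eqVneq (L2norm v) 0.
  by rewrite v0 mulr0 (L2norm_eq0 v0) inner0r.
have vp : 0 < L2norm v by rewrite lt_def v0 L2norm_ge0.
have := sqr_ge0 (L2norm (u + (- Re (inner u v) / L2norm v ^+ 2)%:C *: v)).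
rewrite L2norm_sqrD L2normZ cabsR innerZr cReMR exprMn real_normK ?num_real//.
set p := Re _; set b := L2norm v; set a := L2norm u.
have -> : a ^+ 2 + 2 * (- p / b ^+ 2 * p) + (- p / b ^+ 2) ^+ 2 * b ^+ 2 = a ^+ 2 - p ^+ 2 / b ^+ 2.
  by field.
rewrite subr_ge0 ler_pdivrMr ?exprn_gt0// -exprMn => h.
rewrite (le_trans (ler_norm p))// -(@ler_pXn2r _ 2) ?nnegrE ?mulr_ge0 ?L2norm_ge0//.
by rewrite real_normK ?num_real.
Qed.

(** Multiplying u by the conjugate of <u, v> makes the inner product real, which
    reduces the modulus to the real part. *)
Lemma cabs_inner_le u v : cabs (inner u v) <= L2norm u * L2norm v.
Proof.
set z := inner u v.
have [->|z0] := eqVneq (cabs z) 0; first by rewrite mulr_ge0 ?L2norm_ge0.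
have zp : 0 < cabs z by rewrite lt_def z0 cabs_ge0.
have := Re_inner_le (z^* *: u) v.
rewrite innerZl -/z mulrC mulc_conj cReR L2normZ cabsC expr2 -mulrA.
by rewrite ler_pM2l.
Qed.

Lemma L2normD u v : L2norm (u + v) <= L2norm u + L2norm v.
Proof.
rewrite -(@ler_pXn2r _ 2) ?nnegrE ?addr_ge0 ?L2norm_ge0//.
rewrite L2norm_sqrD sqrrD lerD2r lerD2l -[leRHS]mulr_natl ler_pM2l//.
exact: Re_inner_le.
Qed.

Lemma L2normB u v : L2norm (u - v) <= L2norm u + L2norm v.
Proof. by rewrite (le_trans (L2normD _ _))// L2normN. Qed.

Lemma L2norm_triangle u v w : L2norm (u - w) <= L2norm (u - v) + L2norm (v - w).
Proof. by rewrite (le_trans _ (L2normD _ _))// addrA subrK. Qed.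

Lemma inner_inj u : (forall v, inner u v = 0) -> u = 0.
Proof. by move=> u0; apply: inner_eq0; rewrite u0. Qed.

Lemma le0_eps (x K : R) : (forall e, 0 < e -> x <= e * K) -> x <= 0.
Proof.
move=> h; apply/ler_addgt0Pl => e e0; rewrite addr0.
have d0 : 0 < e / (1 + `|K|) by rewrite divr_gt0// ltr_pwDl.
apply: le_trans (h _ d0) _.
rewrite -mulrA ler_piMr ?(ltW e0)// mulrC ler_pdivrMr ?mul1r ?ltr_pwDl//.
by rewrite (le_trans (ler_norm _))// lerDr.
Qed.

Lemma cabs_le_eps z (K : R) : (forall e : R, 0 < e -> cabs z <= e * K) -> z = 0.
Proof.
move=> /le0_eps h; apply: ComplexField.Normc.eq0_normc.
by apply/eqP; rewrite eq_le cabs_ge0 h.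
Qed.

End L2Norm.

(** * Completeness of L2 *)

Section RieszFischer.
Context d (T : measurableType d) (R : realType) (P : probability T R).
Variables (a : nat -> T -> R) (D q : R).
Hypothesis ma : forall k, measurable_fun setT (a k).
Hypotheses (q0 : 0 <= q) (q1 : q < 1) (D0 : 0 < D).
Hypothesis cauchy_a : forall k m, (k <= m)%N ->
  (\int[P]_x ((a m x - a k x) ^+ 2)%:E <= ((D * q ^+ k) ^+ 2)%:E)%E.

(** An upper limit rather than a limit: it is measurable, and inherits the
    periods shared by all the a k, whether or not the a k converge. *)
Definition L2_limit (x : T) : R := fine (limn_esup (fun k => (a k x)%:E)).

Lemma measurable_L2_limit : measurable_fun setT L2_limit.
Proof.
apply: (measurableT_comp (fine_measurable measurableT)) => //.
by apply: measurable_fun_limn_esup => k; exact/measurable_EFinP.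
Qed.

(** From |b| <= b^2 / (2 e) + e / 2 and the total mass 1 of P, the L^2 bound of
    an increment is also an L^1 bound; e is that bound plus an arbitrarily small
    error, which keeps it positive when q = 0. *)
Let increment_le k : (\int[P]_x `|a k.+1 x - a k x|%:E <= (D * q ^+ k)%:E)%E.
Proof.
suff h (e : R) : 0 < e -> (D * q ^+ k <= e) ->
    (\int[P]_x `|a k.+1 x - a k x|%:E <= e%:E)%E.
  apply/lee_addgt0Pr => e e0; rewrite -EFinD; apply: h.
    by rewrite ltr_wpDl// mulr_ge0 ?exprn_ge0// ltW.
  by rewrite lerDl ltW.
move=> e0 ee.
apply: (@le_trans _ _ (\int[P]_x ((a k.+1 x - a k x) ^+ 2 / (2 * e) + e / 2)%:E)%E).
  apply: ge0_le_integral => //=.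
  - apply/measurable_EFinP/measurableT_comp => //; exact: measurable_funB.
  - apply/measurable_EFinP; apply: measurable_funD => //.
    apply: measurable_funM => //; apply: measurable_funX; exact: measurable_funB.
  - move=> x _; rewrite lee_fin.
    set b := a k.+1 x - a k x.
    have := sqr_ge0 (`|b| - e); rewrite sqrrB real_normK ?num_real// => h.
    have -> : b ^+ 2 / (2 * e) + e / 2 = (b ^+ 2 + e ^+ 2) / (2 * e) by field; rewrite gt_eqF.
    by rewrite ler_pdivlMr ?mulr_gt0//; nra.
under eq_integral do rewrite EFinD mulrC EFinM.
rewrite ge0_integralD//=; last 3 first.
  - by move=> x _; rewrite lee_fin mulr_ge0// ?sqr_ge0// invr_ge0 mulr_ge0// ltW.
  - apply/measurable_EFinP; apply: measurable_funM => //; apply: measurable_funX; exact: measurable_funB.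
  - by move=> x _; rewrite lee_fin divr_ge0// ltW.
rewrite integral_cst// (_ : measure_function.Measure.sort P setT = 1%E) ?mule1; last exact: probability_setT.
rewrite ge0_integralZl//=; last 3 first.
  - by apply/measurable_EFinP; apply: measurable_funX; exact: measurable_funB.
  - by move=> x _; rewrite lee_fin sqr_ge0.
  - by rewrite lee_fin invr_ge0 mulr_ge0// ltW.
apply: (@le_trans _ _ (((2 * e)^-1)%:E * (e ^+ 2)%:E + (e / 2)%:E)%E).
  apply: leeD => //; apply: lee_pmul => //.
  - by rewrite lee_fin invr_ge0 mulr_ge0// ltW.
  - by apply: integral_ge0 => x _; rewrite lee_fin sqr_ge0.
  - apply: le_trans (cauchy_a (leqnSn k)) _.
    by rewrite lee_fin ler_pXn2r ?nnegrE ?(ltW e0)// mulr_ge0 ?exprn_ge0// ltW.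
by rewrite -EFinM -EFinD lee_fin le_eqVlt; apply/orP; left; apply/eqP; field; rewrite gt_eqF.
Qed.

Let increments x : \bar R := (\sum_(0 <= k <oo) `|a k.+1 x - a k x|%:E)%E.

(** By monotone convergence and the geometric series, the sum of the increments
    has a finite integral. *)
Let ae_increments_finite : {ae P, forall x, (increments x < +oo)%E}.
Proof.
have mi k : measurable_fun setT (fun x => `|a k.+1 x - a k x|%:E).
  apply/measurable_EFinP/measurableT_comp => //; exact: measurable_funB.
have int_fin : P.-integrable setT increments.
  apply/integrableP; split.
    apply: ge0_emeasurable_sum => //.
  under eq_integral do rewrite gee0_abs ?nneseries_ge0//.
  rewrite integral_nneseries//.
  apply: (@le_lt_trans _ _ (\sum_(0 <= k <oo) (D * q ^+ k)%:E)%E).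
    apply: lee_nneseries => [k _ _|k _]; last exact: increment_le.
    exact: integral_ge0.
  have := @cvg_geometric_series R D q; rewrite ger0_norm// => /(_ q1) h.
  suff -> : (\sum_(0 <= k <oo) (D * q ^+ k)%:E)%E = (D / (1 - q))%:E by rewrite ltry.
  apply: cvg_lim => //.
  rewrite (_ : (fun _ => _) = EFin \o series (geometric D q)).
    by apply: cvg_comp h _; exact: cvg_id.
  by apply/funext => m /=; rewrite /series/= sumEFin.
have := integrable_ae measurableT int_fin.
apply: filterS => x /(_ I); rewrite ge0_fin_numE//.
by apply: nneseries_ge0.
Qed.

Lemma L2_limit_cvg : {ae P, forall x, a ^~ x @ \oo --> L2_limit x}.
Proof.
apply: filterS ae_increments_finite => x fin.
have cv : cvgn (a ^~ x).
  have : cvgn (series (telescope (a ^~ x))).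
    apply: normed_cvg; apply: nondecreasing_is_cvgn.
      apply: nondecreasing_series => i _ _; exact: normr_ge0.
    exists (fine (increments x)) => _ [m _ <-].
    rewrite -lee_fin fineK ?ge0_fin_numE ?nneseries_ge0//.
    rewrite /series/= -sumEFin.
    exact: (@nneseries_lim_ge _ (fun k => `|a k.+1 x - a k x|%:E) xpredT 0%N m).
  move=> h; rewrite (_ : a ^~ x = cst (a 0%N x) + series (telescope (a ^~ x))).
    by apply: is_cvgD => //; exact: is_cvg_cst.
  apply/funext => m; exact: eq_sum_telescope.
suff -> : L2_limit x = lim (a ^~ x @ \oo) by [].
rewrite /L2_limit.
have cvE : (a k x)%:E @[k --> \oo] --> (lim (a ^~ x @ \oo))%:E.
  by apply: cvg_comp cv _; exact: cvg_id.
by have [_ ->] := cvg_limn_einf_sup cvE.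
Qed.

(** Fatou's lemma for the squares of a m - a k as m grows. *)
Lemma L2_limit_le k :
  (\int[P]_x ((L2_limit x - a k x) ^+ 2)%:E <= ((D * q ^+ k) ^+ 2)%:E)%E.
Proof.
pose f m x := ((a (m + k)%N x - a k x) ^+ 2)%:E.
have mf m : measurable_fun setT (f m).
  by apply/measurable_EFinP; apply: measurable_funX; exact: measurable_funB.
apply: (@le_trans _ _ (\int[P]_x limn_einf (f ^~ x))%E).
  apply: ae_ge0_le_integral => //.
  - by move=> x _; rewrite lee_fin sqr_ge0.
  - apply/measurable_EFinP; apply: measurable_funX; apply: measurable_funB => //.
    exact: measurable_L2_limit.
  - move=> x _; rewrite limn_einf_lim; apply: lime_ge; first exact: is_cvg_einfs.
    by apply: nearW => m; apply: le_ereal_inf_tmp => _ [i _ <-]; rewrite lee_fin sqr_ge0.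
  - rewrite /limn_einf; apply: measurableT_comp => //.
    by apply: measurable_fun_limn_esup => m; exact: measurableT_comp.
  apply: filterS L2_limit_cvg => x cvx _.
  have cvE : f m x @[m --> \oo] --> ((L2_limit x - a k x) ^+ 2)%:E.
    have sh : a (m + k)%N x @[m --> \oo] --> L2_limit x by rewrite (cvg_shiftn k (a ^~ x)).
    have h : (a (m + k)%N x - a k x) ^+ 2 @[m --> \oo] --> (L2_limit x - a k x) ^+ 2.
      by apply: cvgM; apply: cvgB => //; exact: cvg_cst.
    by apply: cvg_comp h _; exact: cvg_id.
  by have [-> _] := cvg_limn_einf_sup cvE.
apply: le_trans (fatou _ _ _ _) _ => //.
  by move=> m x _; rewrite lee_fin sqr_ge0.
rewrite limn_einf_lim; apply: lime_le; first exact: is_cvg_einfs.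
apply: nearW => m; apply: (le_trans _ (cauchy_a (leq_addl m k))).
by apply: ereal_inf_lbound; exists m => /=.
Qed.

End RieszFischer.

Section L2Complete.
Variables (R : realType) (n : nat).
Local Notation point := (n.-tuple (measurableTypeR R)).
Local Notation mu := (torus_measure R n).
Local Notation H := (L2 R n).
Local Notation Re := (@complex.Re R).
Local Notation Im := (@complex.Im R).
Local Open Scope complex_scope.
Local Open Scope quotient_scope.
Local Open Scope ring_scope.

Lemma Lfun2_sqr d (T : measurableType d) (P : {measure set T -> \bar R}) (f : T -> R) :
  measurable_fun setT f -> (\int[P]_x (f x ^+ 2)%:E < +oo)%E -> f \in Lfun P 2%:E.
Proof.
move=> mf lf; rewrite inE; apply/andP; split; rewrite inE//=.
rewrite /finite_norm unlock; apply: poweR_lty.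
rewrite (eq_integral (fun x => (f x ^+ 2)%:E))// => x _.
by rewrite /= powR_mulrn// real_normK ?num_real.
Qed.

Lemma sq_integrableI (f : point -> R[i]) : Defs.periodic f ->
  measurable_fun setT (fun x => Re (f x)) ->
  measurable_fun setT (fun x => Im (f x)) ->
  (\int[mu]_x (Re (f x) ^+ 2 + Im (f x) ^+ 2)%:E < +oo)%E ->
  f \in @sq_integrable R n.
Proof.
move=> fp mr mi fin; apply/sq_integrableP; split=> //; apply: Lfun2_sqr => //;
  apply: le_lt_trans fin; apply: ge0_le_integral => //.
all: try by move=> x _; rewrite lee_fin ?lerDl ?lerDr ?addr_ge0 ?sqr_ge0.
all: by apply/measurable_EFinP; do ?apply: measurable_funD; apply: measurable_funX.
Qed.

Lemma L2fun_measurable (f : L2fun R n) :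
  [/\ Defs.periodic f, measurable_fun setT (fun x => Re (f x)),
      measurable_fun setT (fun x => Im (f x)) &
      (\int[mu]_x (Re (f x) ^+ 2 + Im (f x) ^+ 2)%:E < +oo)%E].
Proof.
have /sq_integrableP[fp /sub_Lfun_mfun mr /sub_Lfun_mfun mi] := L2fun_sq f.
move: mr mi; rewrite !inE => mr mi; split=> //.
by rewrite -Re_inner_pi ltry.
Qed.

Lemma val_insubd_L2fun (f : point -> R[i]) : f \in @sq_integrable R n ->
  insubd (0 : L2fun R n) f = f :> (point -> R[i]).
Proof. by move=> fS; rewrite -[LHS]/(val _) insubdK. Qed.

Lemma L2norm_pi_sqr (f : L2fun R n) :
  (L2norm (\pi_H f) ^+ 2)%:E = (\int[mu]_x (Re (f x) ^+ 2 + Im (f x) ^+ 2)%:E)%E.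
Proof. by rewrite L2norm_sqr Re_inner_pi. Qed.

Lemma pi_L2B (f g : L2fun R n) : \pi_H (f - g) = \pi_H f - \pi_H g.
Proof. by rewrite addrC -scaleN1r pi_L2_lin scaleN1r addrC. Qed.

Lemma L2normB_pi_sqr (f g : L2fun R n) :
  (L2norm (\pi_H f - \pi_H g) ^+ 2)%:E =
  (\int[mu]_x ((Re (f x) - Re (g x)) ^+ 2 + (Im (f x) - Im (g x)) ^+ 2)%:E)%E.
Proof.
rewrite -pi_L2B L2norm_pi_sqr; apply: eq_integral => x _.
have /(congr1 (@^~ x)) := raddfB (\val : L2fun R n -> _) f g; rewrite /= => ->.
by rewrite fctE cReD cImD cReN cImN.
Qed.

Lemma geometric_cauchy (u : nat -> H) (C q : R) : 0 <= C -> 0 <= q -> q < 1 ->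
  (forall k, L2norm (u k.+1 - u k) <= C * q ^+ k) ->
  forall k m, (k <= m)%N -> L2norm (u m - u k) <= C / (1 - q) * q ^+ k.
Proof.
move=> C0 q0 q1 h k m /subnKC <-; set j := (m - k)%N.
have p0 : 0 < 1 - q by rewrite subr_gt0.
suff : L2norm (u (k + j)%N - u k) <= C / (1 - q) * q ^+ k * (1 - q ^+ j).
  move=> /le_trans; apply; apply: ler_piMr.
    by rewrite mulr_ge0 ?exprn_ge0// divr_ge0// ltW.
  by rewrite lerBlDr lerDl exprn_ge0.
elim: j => [|j IH]; first by rewrite addn0 subrr L2norm0 expr0 subrr mulr0.
rewrite addnS (le_trans (L2norm_triangle _ (u (k + j)%N) _))//.
apply: le_trans (lerD (h _) IH) _; rewrite exprD exprS le_eqVlt; apply/orP; left; apply/eqP.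
by field; rewrite gt_eqF.
Qed.

(** The limit is formed for the real and imaginary parts separately, whence the
    factor 2; C + 1 instead of C makes the constant positive. *)
Theorem L2_geometric_limit (u : nat -> H) (C q : R) : 0 <= C -> 0 <= q -> q < 1 ->
  (forall k, L2norm (u k.+1 - u k) <= C * q ^+ k) ->
  exists l, forall k, L2norm (l - u k) <= 2 * ((C + 1) / (1 - q)) * q ^+ k.
Proof.
move=> C0 q0 q1 h.
have p0 : 0 < 1 - q by rewrite subr_gt0.
pose D := (C + 1) / (1 - q).
have D0 : 0 < D by rewrite divr_gt0// ltr_pwDr.
pose f k := repr (u k).
pose a k x := Re (f k x); pose b k x := Im (f k x).
have cauchy k m : (k <= m)%N -> L2norm (u m - u k) <= D * q ^+ k.
  move=> km; apply: le_trans (geometric_cauchy C0 q0 q1 h km) _.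
  by rewrite ler_wpM2r ?exprn_ge0// ler_pM2r ?invr_gt0// lerDl.
have cauchyE k m : (k <= m)%N ->
    (\int[mu]_x ((a m x - a k x) ^+ 2 + (b m x - b k x) ^+ 2)%:E <= ((D * q ^+ k) ^+ 2)%:E)%E.
  move=> km; rewrite -L2normB_pi_sqr !reprK lee_fin ler_pXn2r ?nnegrE ?L2norm_ge0 ?cauchy//.
  by rewrite mulr_ge0 ?exprn_ge0// ltW.
have ma k : measurable_fun setT (a k) by have [] := L2fun_measurable (f k).
have mb k : measurable_fun setT (b k) by have [] := L2fun_measurable (f k).
have msq k m (c : nat -> point -> R) : (forall k, measurable_fun setT (c k)) ->
    measurable_fun setT (fun x : point => ((c m x - c k x) ^+ 2)).
  by move=> mc; apply: measurable_funX; exact: measurable_funB.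
have ca k m : (k <= m)%N -> (\int[mu]_x ((a m x - a k x) ^+ 2)%:E <= ((D * q ^+ k) ^+ 2)%:E)%E.
  move=> km; apply: le_trans (cauchyE _ _ km); apply: ge0_le_integral => //.
  - by move=> x _; rewrite lee_fin sqr_ge0.
  - by apply/measurable_EFinP; exact: msq.
  - by apply/measurable_EFinP; apply: measurable_funD; exact: msq.
  - by move=> x _; rewrite lee_fin lerDl sqr_ge0.
have cb k m : (k <= m)%N -> (\int[mu]_x ((b m x - b k x) ^+ 2)%:E <= ((D * q ^+ k) ^+ 2)%:E)%E.
  move=> km; apply: le_trans (cauchyE _ _ km); apply: ge0_le_integral => //.
  - by move=> x _; rewrite lee_fin sqr_ge0.
  - by apply/measurable_EFinP; exact: msq.
  - by apply/measurable_EFinP; apply: measurable_funD; exact: msq.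
  - by move=> x _; rewrite lee_fin lerDr sqr_ge0.
pose A := L2_limit a; pose B := L2_limit b.
have mA : measurable_fun setT A by exact: measurable_L2_limit.
have mB : measurable_fun setT B by exact: measurable_L2_limit.
have intAB k : (\int[mu]_x ((A x - a k x) ^+ 2 + (B x - b k x) ^+ 2)%:E
    <= (2 * (D * q ^+ k) ^+ 2)%:E)%E.
  under eq_integral do rewrite EFinD.
  rewrite ge0_integralD//=; last 4 first.
  - by move=> x _; rewrite lee_fin sqr_ge0.
  - by apply/measurable_EFinP; apply: measurable_funX; exact: measurable_funB.
  - by move=> x _; rewrite lee_fin sqr_ge0.
  - by apply/measurable_EFinP; apply: measurable_funX; exact: measurable_funB.
  rewrite mulr_natl mulr2n EFinD; apply: leeD.
    exact: (L2_limit_le ma q0 q1 D0 ca).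
  exact: (L2_limit_le mb q0 q1 D0 cb).
(* [intAB] bounds the distance to a 0 and b 0, which are added back in g *)
pose g0 x := (A x - a 0%N x) +i* (B x - b 0%N x).
have fper k : Defs.periodic (f k) by have [] := L2fun_measurable (f k).
have g0S : g0 \in @sq_integrable R n.
  apply: sq_integrableI => /=.
  - move=> i x; rewrite /g0 /A /B /L2_limit /a /b; congr (_ +i* _);
      by congr (fine (limn_esup _) - _); rewrite ?fper//; apply/funext => k; rewrite fper.
  - exact: measurable_funB.
  - exact: measurable_funB.
  - by apply: le_lt_trans (intAB 0%N) _; rewrite ltry.
pose g : L2fun R n := insubd (0 : L2fun R n) g0 + f 0%N.
have gE x : g x = A x +i* B x.
  have /(congr1 (@^~ x)) := raddfD (\val : L2fun R n -> _) (insubd (0 : L2fun R n) g0) (f 0%N).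
  rewrite /= => ->; rewrite fctE val_insubd_L2fun// /g0 /a /b.
  by apply: complex_eq; rewrite ?cReD ?cImD/= subrK.
exists (\pi_H g) => k.
have gk : (L2norm (\pi_H g - u k) ^+ 2)%:E =
    (\int[mu]_x ((A x - a k x) ^+ 2 + (B x - b k x) ^+ 2)%:E)%E.
  by rewrite -[u k]reprK L2normB_pi_sqr; apply: eq_integral => x _; rewrite gE.
rewrite -(@ler_pXn2r _ 2) ?nnegrE ?L2norm_ge0//; last first.
  by rewrite mulr_ge0 ?exprn_ge0// mulr_ge0// ltW.
rewrite -lee_fin gk; apply: le_trans (intAB k) _.
by rewrite lee_fin -mulrA [leRHS]exprMn ler_wpM2r ?sqr_ge0// expr2; lra.
Qed.

End L2Complete.

(** * Weighted translations *)

Section WeightedTranslation.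
Variables (R : realType) (n : nat).
Local Notation point := (n.-tuple (measurableTypeR R)).
Local Notation mu := (torus_measure R n).
Local Notation H := (L2 R n).
Local Notation Re := (@complex.Re R).
Local Notation Im := (@complex.Im R).
Local Open Scope complex_scope.
Local Open Scope quotient_scope.
Local Open Scope ring_scope.

Lemma translate_translate (s t : 'cV[R]_n) (x : point) :
  translate s (translate t x) = translate (s + t) x.
Proof. by apply: eq_from_tnth => i; rewrite !tnth_mktuple mxE -addrA (addrC (t _ _)). Qed.

Lemma translate0 (x : point) : translate 0 x = x.
Proof. by apply: eq_from_tnth => i; rewrite !tnth_mktuple mxE addr0. Qed.

Lemma periodic_translate (f : point -> R[i]) s : Defs.periodic f ->
  Defs.periodic (fun x => f (translate s x)).
Proof. by move=> fp k x; rewrite translate_translate addrC -translate_translate fp. Qed.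

Lemma integral_torus_translate (f : point -> \bar R) (s : 'cV[R]_n) :
  measurable_fun [set: _] f ->
  (forall k x, f (translate (2 * pi *: delta_mx k ord0)%R x) = f x) ->
  (\int[mu]_x f (translate s x) = \int[mu]_x f x)%E.
Proof.
move=> mf fp; rewrite [LHS]integralE [RHS]integralE; congr (_ - _)%E.
  rewrite -[RHS](ge0_integral_torus_translate s)//.
  - by apply: eq_integral => x _; rewrite ?funeposE ?funenegE.
  - exact: measurable_funepos.
  - by move=> k x; rewrite !funeposE fp.
rewrite -[RHS](ge0_integral_torus_translate s)//.
- by apply: eq_integral => x _; rewrite ?funeposE ?funenegE.
- exact: measurable_funeneg.
- by move=> k x; rewrite !funenegE fp.
Qed.

Lemma cintegral_translate (f : point -> R[i]) s : Defs.periodic f ->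
  measurable_fun setT (fun x => Re (f x)) ->
  measurable_fun setT (fun x => Im (f x)) ->
  cintegral (fun x => f (translate s x)) = cintegral f.
Proof.
move=> fp mr mi; apply: complex_eq; congr fine.
  apply: (@integral_torus_translate (fun x => (Re (f x))%:E)); first exact/measurable_EFinP.
  by move=> k x; rewrite fp.
apply: (@integral_torus_translate (fun x => (Im (f x))%:E)); first exact/measurable_EFinP.
by move=> k x; rewrite fp.
Qed.

Definition phase (phi : point -> R[i]) :=
  [/\ Defs.periodic phi, measurable_fun setT (fun x => Re (phi x)),
      measurable_fun setT (fun x => Im (phi x)) &
      forall x, Re (phi x) ^+ 2 + Im (phi x) ^+ 2 = 1].

Definition wtrans phi s (f : L2fun R n) : L2fun R n :=
  insubd (0 : L2fun R n) (fun x => phi x * f (translate s x)).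

(** Both V_s and U_j have this form, with phi = 1 and phi = exp (i x_j). *)
Definition wtrans_op phi s : L2op R n :=
  fun u => L2_class (fun x => phi x * repr u (translate s x)).

Lemma wtransE phi s f x : phase phi -> wtrans phi s f x = phi x * f (translate s x).
Proof.
move=> [phip mr mi phi1]; rewrite /wtrans val_insubd_L2fun//.
have [fp fr fi ffin] := L2fun_measurable f.
have mt := measurable_translate s.
have mfr : measurable_fun setT (fun x => Re (f (translate s x))) by exact: (measurableT_comp fr).
have mfi : measurable_fun setT (fun x => Im (f (translate s x))) by exact: (measurableT_comp fi).
apply: sq_integrableI.
- by move=> k y; rewrite phip (periodic_translate s fp).
- under eq_fun do rewrite cReM.
  by apply: measurable_funB; apply: measurable_funM.
- under eq_fun do rewrite cImM.
  by apply: measurable_funD; apply: measurable_funM.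
- apply: le_lt_trans ffin; rewrite le_eqVlt; apply/orP; left; apply/eqP.
  rewrite -[RHS](ge0_integral_torus_translate s).
  + apply: eq_integral => y _; congr EFin; rewrite cReM cImM -[RHS]mul1r -(phi1 y); ring.
  + by apply/measurable_EFinP; apply: measurable_funD; apply: measurable_funX.
  + by move=> y; rewrite lee_fin addr_ge0 ?sqr_ge0.
  + by move=> k y; rewrite fp.
Qed.

(** The phase of the adjoint, which translates by - s. *)
Definition cophase phi s : point -> R[i] := fun x => (phi (translate (- s) x))^*.

Lemma phase_cophase phi s : phase phi -> phase (cophase phi s).
Proof.
move=> [phip mr mi phi1]; have mt := measurable_translate (- s).
split=> [k x|||x].
- by rewrite /cophase (periodic_translate (- s) phip).
- under eq_fun do rewrite cReJ; exact: (measurableT_comp mr).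
- under eq_fun do rewrite cImJ; apply: measurable_funN; exact: (measurableT_comp mi).
- by rewrite cReJ cImJ sqrrN.
Qed.

(** Invariance of the integral under the translation by - s moves the operator
    to the other side. *)
Lemma inner_wtrans phi s (f g : L2fun R n) : phase phi ->
  inner (\pi_H (wtrans phi s f)) (\pi_H g) =
  inner (\pi_H f) (\pi_H (wtrans (cophase phi s) (- s) g)).
Proof.
move=> phiP; rewrite !inner_pi.
have cp := phase_cophase s phiP.
have ci := L2funM_cintegrable f (wtrans (cophase phi s) (- s) g).
have [fp _ _ _] := L2fun_measurable f.
have [gp _ _ _] := L2fun_measurable (wtrans (cophase phi s) (- s) g).
have [mr mi] := measurable_cintegrable ci.
rewrite -(cintegral_translate s _ mr mi); last by move=> k x; rewrite fp gp.
congr cintegral; apply/funext => x.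
rewrite !wtransE// /cophase !translate_translate addNr translate0 rmorphM/= conjCK.
by rewrite mulrCA mulrA.
Qed.

(** Independence of the representative: paired with the class of g, both sides
    give the inner product of the class of f with the adjoint translate of g. *)
Lemma wtrans_op_pi phi s f : phase phi -> wtrans_op phi s (\pi_H f) = \pi_H (wtrans phi s f).
Proof.
move=> phiP; apply/eqP; rewrite -subr_eq0; apply/eqP/inner_inj => w; rewrite innerBl.
rewrite -[w]reprK -[wtrans_op _ _ _]/(\pi_H (wtrans phi s (repr (\pi_H f)))).
by rewrite !inner_wtrans// reprK subrr.
Qed.

Lemma wtrans_op_adjoint phi s : phase phi ->
  is_adjoint (wtrans_op phi s) (wtrans_op (cophase phi s) (- s)).
Proof.
move=> phiP u v; rewrite -[u]reprK -[v]reprK !wtrans_op_pi ?inner_wtrans//.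
exact: phase_cophase.
Qed.

Lemma wtransK phi s f : phase phi -> wtrans (cophase phi s) (- s) (wtrans phi s f) = f.
Proof.
move=> phiP; apply: val_inj; apply/funext => x.
rewrite /= wtransE; last exact: phase_cophase.
rewrite wtransE// translate_translate subrr translate0 mulrA /cophase.
case: phiP => _ _ _ /(_ (translate (- s) x)) h.
rewrite [X in X * _](_ : _ = 1) ?mul1r//.
by apply: complex_eq; rewrite ?cReM ?cImM cReJ cImJ/= -?h; ring.
Qed.

Lemma L2norm_wtrans_op phi s u : phase phi -> L2norm (wtrans_op phi s u) = L2norm u.
Proof.
move=> phiP; rewrite /L2norm -[u]reprK wtrans_op_pi// inner_wtrans//.
by rewrite wtransK.
Qed.

End WeightedTranslation.

(** * Bounded operators with an adjoint *)

Section Operators.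
Variables (R : realType) (n : nat).
Local Notation H := (L2 R n).
Local Notation op := (L2op R n).
Local Notation Re := (@complex.Re R).
Local Notation cabs := (@ComplexField.Normc.normc R).
Local Open Scope complex_scope.
Local Open Scope ring_scope.
Implicit Types (S T : op) (u v w : H).

Lemma small_expr (q e : R) : 0 <= q -> q < 1 -> 0 < e -> exists N, q ^+ N <= e.
Proof.
move=> q0 q1 e0; have /cvgr0Pnorm_lt/(_ e e0) : GRing.exp q @ \oo --> (0 : R).
  by apply: cvg_expr; rewrite ger0_norm.
move=> [N _ /(_ N (leqnn N))] /= h; exists N.
by rewrite (le_trans (ler_norm _))// ltW.
Qed.

(** The constant is proportional to C: for the sequence T_k u of images of a
    vector, where C = c |u|, this gives a limit in operator norm. *)
Lemma L2_complete (u : nat -> H) (C q : R) : 0 <= C -> 0 <= q -> q < 1 ->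
  (forall k, L2norm (u k.+1 - u k) <= C * q ^+ k) ->
  exists l, forall k, L2norm (u k - l) <= C / (1 - q) * q ^+ k.
Proof.
move=> C0 q0 q1 h; have [l hl] := L2_geometric_limit C0 q0 q1 h.
exists l => k; rewrite -subr_le0.
apply: (@le0_eps _ _ (2 * ((C + 1) / (1 - q)))) => e e0.
have [N hN] := small_expr q0 q1 e0.
rewrite lerBlDr (le_trans (L2norm_triangle _ (u (k + N)%N) _))// [leRHS]addrC lerD//.
  by rewrite L2normBC (geometric_cauchy C0 q0 q1 h)// leq_addr.
rewrite L2normBC (le_trans (hl _))// mulrC ler_wpM2r//.
  by rewrite mulr_ge0// divr_ge0 ?subr_ge0 ?ltW// ltr_pwDr.
rewrite exprD (le_trans _ hN)// ler_piMl ?exprn_ge0//.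
by rewrite exprn_ile1// ltW.
Qed.

Definition linear_op T := forall a u v, T (a *: u + v) = a *: T u + T v.
Definition bounded_op T := exists2 c : R, 0 <= c & opnorm_le T c.
(** Linearity follows from the existence of an adjoint. The adjoint is part
    of the notion so that the adjoint of a norm limit is a limit of adjoints. *)
Definition adjointable T := bounded_op T /\ exists S, is_adjoint T S.

Lemma lin0 T : linear_op T -> T 0 = 0.
Proof. by move=> /(_ (-1) 0 0); rewrite scaler0 addr0 scaleN1r addNr. Qed.
Lemma linD T : linear_op T -> {morph T : u v / u + v}.
Proof. by move=> lT u v; rewrite -[u]scale1r lT !scale1r. Qed.
Lemma linZ T : linear_op T -> forall a u, T (a *: u) = a *: T u.
Proof. by move=> lT a u; rewrite -[a *: u]addr0 lT lin0// addr0. Qed.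
Lemma linN T : linear_op T -> {morph T : u / - u}.
Proof. by move=> lT u; rewrite -scaleN1r linZ// scaleN1r. Qed.
Lemma linB T : linear_op T -> {morph T : u v / u - v}.
Proof. by move=> lT u v; rewrite linD// linN. Qed.
Lemma lin_sum T : linear_op T -> forall I (r : seq I) (P : pred I) (F : I -> H),
  T (\sum_(i <- r | P i) F i) = \sum_(i <- r | P i) T (F i).
Proof.
move=> lT I r P F; elim/big_rec2: _ => [|i y1 y2 _ <-]; first exact: lin0.
exact: linD.
Qed.

Lemma is_adjointC T S : is_adjoint T S -> is_adjoint S T.
Proof. by move=> h u v; rewrite innerC -h -innerC. Qed.

Lemma is_adjoint_lin T S : is_adjoint T S -> linear_op T.
Proof.
move=> h a u v; apply/eqP; rewrite -subr_eq0; apply/eqP/inner_inj => w.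
by rewrite innerBl innerDZl !h innerDZl subrr.
Qed.

Lemma is_adjoint_uniq T S S' : is_adjoint T S -> is_adjoint T S' -> S = S'.
Proof.
move=> h h'; apply/funext => u; apply/eqP; rewrite -subr_eq0; apply/eqP/inner_inj => w.
by rewrite innerC innerBr -h -h' subrr rmorph0.
Qed.

Lemma adjE T S : is_adjoint T S -> adj T = S.
Proof.
move=> h; apply: (@is_adjoint_uniq T) => //.
by rewrite /adj; case: xgetP => [x _ //|/(_ S)]; case.
Qed.

Lemma adjointable_lin T : adjointable T -> linear_op T.
Proof. by move=> [_ [S]]; exact: is_adjoint_lin. Qed.

Lemma adjointable_bounded T : adjointable T -> bounded_op T. Proof. by case. Qed.

Lemma is_adjoint_adj T : adjointable T -> is_adjoint T (adj T).
Proof. by move=> [_ [S h]]; rewrite (adjE h). Qed.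

Lemma opnorm_leW T c c' : c <= c' -> opnorm_le T c -> opnorm_le T c'.
Proof. by move=> cc h u; rewrite (le_trans (h u))// ler_wpM2r ?L2norm_ge0. Qed.

Lemma opnorm_leD T S c c' : opnorm_le T c -> opnorm_le S c' -> opnorm_le (T + S) (c + c').
Proof. by move=> h h' u; rewrite mulrDl (le_trans (L2normD _ _))// lerD. Qed.

Lemma opnorm_leN T c : opnorm_le T c -> opnorm_le (- T) c.
Proof. by move=> h u; rewrite L2normN. Qed.

Lemma opnorm_leB T S c c' : opnorm_le T c -> opnorm_le S c' -> opnorm_le (T - S) (c + c').
Proof. by move=> h h'; apply: opnorm_leD => //; exact: opnorm_leN. Qed.

Lemma opnorm_leBC T S c : opnorm_le (T - S) c -> opnorm_le (S - T) c.
Proof. by move=> h; rewrite -opprB; exact: opnorm_leN. Qed.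

Lemma opnorm_leZ a T c : opnorm_le T c -> opnorm_le (a *: T) (cabs a * c).
Proof. by move=> h u; rewrite L2normZ -mulrA ler_wpM2l ?cabs_ge0. Qed.

Lemma opnorm_leM T S c c' : 0 <= c -> opnorm_le T c -> opnorm_le S c' ->
  opnorm_le (T \o S) (c * c').
Proof. by move=> c0 h h' u; rewrite (le_trans (h _))// -mulrA ler_wpM2l. Qed.

Lemma opnorm_le00 : opnorm_le (0 : op) 0.
Proof. by move=> u; rewrite mul0r L2norm0. Qed.

Lemma opnorm_le_idfun : opnorm_le (idfun : op) 1.
Proof. by move=> u; rewrite mul1r. Qed.

Lemma opnorm_le_adjoint T S c : 0 <= c -> is_adjoint T S -> opnorm_le T c -> opnorm_le S c.
Proof.
move=> c0 h hT u; have [->|Su0] := eqVneq (L2norm (S u)) 0.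
  by rewrite mulr_ge0 ?L2norm_ge0.
have Sp : 0 < L2norm (S u) by rewrite lt_def Su0 L2norm_ge0.
rewrite -(ler_pM2l Sp) -expr2 L2norm_sqr -h.
apply: le_trans (Re_inner_le _ _) _.
by rewrite mulrCA mulrA ler_wpM2r ?L2norm_ge0// mulrC.
Qed.

Lemma is_adjointD T S T' S' : is_adjoint T S -> is_adjoint T' S' -> is_adjoint (T + T') (S + S').
Proof. by move=> h h' u v; rewrite innerDl innerDr h h'. Qed.
Lemma is_adjointN T S : is_adjoint T S -> is_adjoint (- T) (- S).
Proof. by move=> h u v; rewrite innerNl innerNr h. Qed.
Lemma is_adjointZ a T S : is_adjoint T S -> is_adjoint (a *: T) (a^* *: S).
Proof. by move=> h u v; rewrite innerZl innerZr conjCK h. Qed.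
Lemma is_adjointM T S T' S' : is_adjoint T S -> is_adjoint T' S' -> is_adjoint (T \o T') (S' \o S).
Proof. by move=> h h' u v; rewrite /= h h'. Qed.
Lemma is_adjoint0 : is_adjoint (0 : op) 0.
Proof. by move=> u v; rewrite inner0l inner0r. Qed.
Lemma is_adjoint_idfun : is_adjoint (idfun : op) idfun.
Proof. by []. Qed.

Lemma adjointableD T S : adjointable T -> adjointable S -> adjointable (T + S).
Proof.
move=> [[c c0 h] [T' hT]] [[c' c0' h'] [S' hS]]; split.
  by exists (c + c'); [exact: addr_ge0|exact: opnorm_leD].
by exists (T' + S'); exact: is_adjointD.
Qed.

Lemma adjointableZ a T : adjointable T -> adjointable (a *: T).
Proof.
move=> [[c c0 h] [T' hT]]; split; last by exists (a^* *: T'); exact: is_adjointZ.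
by exists (cabs a * c); [rewrite mulr_ge0 ?cabs_ge0|exact: opnorm_leZ].
Qed.

Lemma adjointableN T : adjointable T -> adjointable (- T).
Proof. by rewrite -scaleN1r; exact: adjointableZ. Qed.
Lemma adjointableB T S : adjointable T -> adjointable S -> adjointable (T - S).
Proof. by move=> h /adjointableN; exact: adjointableD. Qed.

Lemma adjointableM T S : adjointable T -> adjointable S -> adjointable (T \o S).
Proof.
move=> [[c c0 h] [T' hT]] [[c' c0' h'] [S' hS]]; split.
  by exists (c * c'); [exact: mulr_ge0|exact: opnorm_leM].
by exists (S' \o T'); exact: is_adjointM.
Qed.

Lemma adjointable0 : adjointable (0 : op).
Proof. by split; [exists 0 => //; exact: opnorm_le00|exists 0; exact: is_adjoint0]. Qed.

Lemma adjointable_idfun : adjointable (idfun : op).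
Proof. by split; [exists 1 => //; exact: opnorm_le_idfun|exists idfun]. Qed.

Lemma adjointable_sum I (r : seq I) (P : pred I) (F : I -> op) :
  (forall i, P i -> adjointable (F i)) -> adjointable (\sum_(i <- r | P i) F i).
Proof. by move=> h; apply: big_ind => //; [exact: adjointable0|exact: adjointableD]. Qed.

Lemma is_adjoint_adjointable T S : adjointable T -> is_adjoint T S -> adjointable S.
Proof.
move=> [[c c0 h] _] hS; split; last by exists T; exact: is_adjointC.
by exists c => //; exact: opnorm_le_adjoint hS h.
Qed.

Lemma adjointable_adj T : adjointable T -> adjointable (adj T).
Proof. by move=> h; apply: (is_adjoint_adjointable h); exact: is_adjoint_adj. Qed.

Lemma adjK T : adjointable T -> adj (adj T) = T.
Proof. by move=> h; apply: adjE; apply: is_adjointC; exact: is_adjoint_adj. Qed.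
Lemma adjM T S : adjointable T -> adjointable S -> adj (T \o S) = adj S \o adj T.
Proof. by move=> h h'; apply: adjE; apply: is_adjointM; exact: is_adjoint_adj. Qed.
Lemma adj_sum I (r : seq I) (P : pred I) (F : I -> op) :
  (forall i, P i -> adjointable (F i)) ->
  adj (\sum_(i <- r | P i) F i) = \sum_(i <- r | P i) adj (F i).
Proof.
move=> h; apply: adjE.
apply: (big_ind2 (fun a b : op => is_adjoint a b)); first exact: is_adjoint0.
  by move=> *; exact: is_adjointD.
by move=> i Pi; apply: is_adjoint_adj; exact: h.
Qed.

Section Cvg.
Context {I : Type} (F : set_system I) {FF : ProperFilter F}.
Implicit Types f g : I -> op.

Lemma op_cvg_uniq f S T : op_cvg f F S -> op_cvg f F T -> S = T.
Proof.
move=> hS hT; apply/funext => u; apply/eqP; rewrite -subr_eq0; apply/eqP/L2norm_le0.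
apply: (@le0_eps _ _ (2 * L2norm u)) => e e0.
have [i [h1 h2]] := filter_ex (filterI (hS e e0) (hT e e0)).
rewrite (le_trans (L2norm_triangle _ (f i u) _))// L2normBC.
by rewrite mulrCA mulr_natl mulr2n lerD//; [exact: h1|exact: h2].
Qed.

Lemma op_cvg_cst T : op_cvg (fun=> T) F T.
Proof.
move=> e e0; apply: nearW => i; rewrite subrr.
by apply: opnorm_leW opnorm_le00; exact: ltW.
Qed.

Lemma op_cvgD f g S T : op_cvg f F S -> op_cvg g F T -> op_cvg (fun i => f i + g i) F (S + T).
Proof.
move=> hf hg e e0; have e20 : 0 < e / 2 by rewrite divr_gt0.
apply: filterS2 (hf _ e20) (hg _ e20) => i h1 h2.
rewrite opprD addrACA [e]splitr; exact: opnorm_leD.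
Qed.

Lemma op_cvgZ a f S : op_cvg f F S -> op_cvg (fun i => a *: f i) F (a *: S).
Proof.
move=> hf e e0; have d0 : 0 < e / (1 + cabs a) by rewrite divr_gt0// ltr_pwDl// cabs_ge0.
apply: filterS (hf _ d0) => i h.
rewrite -scalerBr; apply: opnorm_leW (opnorm_leZ a h).
rewrite mulrA ler_pdivrMr ?ltr_pwDl ?cabs_ge0// mulrC ler_pM2l//.
by rewrite lerDr.
Qed.

Lemma op_cvgM f g S T : linear_op S -> bounded_op S -> bounded_op T ->
  op_cvg f F S -> op_cvg g F T -> op_cvg (fun i => f i \o g i) F (S \o T).
Proof.
move=> lS [a a0 ha] [b b0 hb] hf hg e e0.
pose d1 := Num.min 1 (e / (2 * (1 + a))).
have a10 : 0 < 1 + a by rewrite ltr_pwDl.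
have b20 : 0 < 2 + b by rewrite ltr_pwDl.
have d10 : 0 < d1 by rewrite lt_min ltr01 divr_gt0// mulr_gt0.
have d20 : 0 < e / (2 * (2 + b)) by rewrite divr_gt0// mulr_gt0.
apply: filterS2 (hf _ d20) (hg _ d10) => i h1 h2.
have -> : (f i \o g i) - (S \o T) = ((f i - S) \o g i) + (S \o (g i - T)).
  apply/funext => u; rewrite -[LHS]/(f i (g i u) - S (T u)).
  by rewrite -[RHS]/(f i (g i u) - S (g i u) + S (g i u - T u)) linB// addrA subrK.
have hgi : opnorm_le (g i) (2 + b).
  rewrite -[g i](subrK T); apply: opnorm_leD => //; apply: opnorm_leW h2.
  by rewrite ge_min; apply/orP; left; rewrite ler1n.
rewrite [e]splitr; apply: opnorm_leD.
  apply: opnorm_leW (opnorm_leM (ltW d20) h1 hgi).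
  by rewrite le_eqVlt; apply/orP; left; apply/eqP; field; rewrite gt_eqF.
apply: opnorm_leW (opnorm_leM a0 ha h2).
apply: (@le_trans _ _ ((1 + a) * (e / (2 * (1 + a))))).
  apply: ler_pM => //; [by rewrite ltW|by rewrite lerDr|by rewrite ge_min lexx orbT].
by rewrite le_eqVlt; apply/orP; left; apply/eqP; field; rewrite gt_eqF.
Qed.

Lemma op_cvg_adj f T : (forall i, adjointable (f i)) -> adjointable T ->
  op_cvg f F T -> op_cvg (fun i => adj (f i)) F (adj T).
Proof.
move=> gf gT h e e0; apply: filterS (h e e0) => i hi.
apply: opnorm_le_adjoint (ltW e0) _ hi.
by apply: is_adjointD; [exact: is_adjoint_adj|apply: is_adjointN; exact: is_adjoint_adj].
Qed.

End Cvg.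

Lemma op_cvg_geometric (f : nat -> op) (C q : R) : 0 <= C -> 0 <= q -> q < 1 ->
  (forall k, opnorm_le (f k.+1 - f k) (C * q ^+ k)) ->
  exists2 T, op_cvg f \oo T & forall k, opnorm_le (f k - T) (C / (1 - q) * q ^+ k).
Proof.
move=> C0 q0 q1 h.
have /choice[T hT] : forall u, exists l, forall k, L2norm (f k u - l) <= C * L2norm u / (1 - q) * q ^+ k.
  move=> u.
  apply: (@L2_complete (fun k => f k u)) => // [|k]; first by rewrite mulr_ge0 ?L2norm_ge0.
  by rewrite mulrAC; exact: h.
have hT' k : opnorm_le (f k - T) (C / (1 - q) * q ^+ k).
  move=> u; rewrite (le_trans (hT u k))// le_eqVlt; apply/orP; left; apply/eqP; ring.
exists T => // e e0.
have p0 : 0 < 1 - q by rewrite subr_gt0.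
have d0 : 0 < e / (1 + C / (1 - q)) by rewrite divr_gt0// ltr_pwDl// divr_ge0// ltW.
have [N hN] := small_expr q0 q1 d0.
exists N => // k /= Nk; apply: opnorm_leW (hT' k).
have hk : q ^+ k <= e / (1 + C / (1 - q)).
  apply: le_trans hN; rewrite -(subnKC Nk) exprD ler_piMr ?exprn_ge0//.
  by rewrite exprn_ile1// ltW.
have K0 : 0 <= C / (1 - q) by rewrite divr_ge0// ltW.
apply: le_trans (ler_wpM2l K0 hk) _.
rewrite mulrA ler_pdivrMr ?ltr_pwDl// mulrC ler_pM2l//.
by rewrite lerDr.
Qed.

(** An operator and its adjoint have the same bounds, so along a subsequence that
    converges geometrically the adjoints converge too, to an adjoint of T. *)
Lemma adjointable_lim (f : nat -> op) T :
  (forall k, adjointable (f k)) -> op_cvg f \oo T -> adjointable T.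
Proof.
move=> gf fT; split.
  have [k hk] := filter_ex (fT 1 ltr01).
  have [c c0 hc] := adjointable_bounded (gf k).
  exists (c + 1); first by rewrite addr_ge0.
  rewrite -[T](subKr (f k)); exact: opnorm_leB.
have half0 : 0 <= 2^-1 :> R by rewrite invr_ge0.
have half1 : 2^-1 < 1 :> R by rewrite invf_lt1// ltr1n.
have /choice[k hk] : forall j, exists k, opnorm_le (f k - T) (2^-1 ^+ j).
  by move=> j; apply: (filter_ex (fT _ _)); rewrite exprn_gt0// invr_gt0.
pose g j := f (k j).
have adjB i j : is_adjoint (g i - g j) (adj (g i) - adj (g j)).
  by apply: is_adjointD; [|apply: is_adjointN]; exact: (is_adjoint_adj (gf _)).
have hS j : opnorm_le (adj (g j.+1) - adj (g j)) (2 * 2^-1 ^+ j).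
  apply: opnorm_le_adjoint (adjB _ _) _; first by rewrite mulr_ge0// exprn_ge0.
  have -> : g j.+1 - g j = (g j.+1 - T) - (g j - T) by rewrite opprB addrA subrK.
  apply: opnorm_leW (opnorm_leB (hk _) (hk _)).
  by rewrite mulr_natl mulr2n lerD2r exprS ler_piMl ?exprn_ge0// ltW.
have [S _ hl] := op_cvg_geometric (ler0n _ _) half0 half1 hS.
exists S => u v; apply/eqP; rewrite -subr_eq0; apply/eqP.
apply: (@cabs_le_eps _ _ (L2norm u * L2norm v + 2 / (1 - 2^-1) * (L2norm u * L2norm v))).
move=> e e0; have [N hN] := small_expr half0 half1 e0.
have -> : inner (T u) v - inner u (S v) = inner ((T - g N) u) v + inner u ((adj (g N) - S) v).
  rewrite -[(T - g N) u]/(T u - g N u) -[(adj (g N) - S) v]/(adj (g N) v - S v).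
  by rewrite innerBl innerBr (is_adjoint_adj (gf _)) addrA subrK.
have tri (x y : R[i]) : cabs (x + y) <= cabs x + cabs y.
  have := ler_normD x y; rewrite -lecR rmorphD/=; exact.
apply: le_trans (tri _ _) _.
rewrite mulrDr; apply: lerD; apply: le_trans (cabs_inner_le _ _) _.
  rewrite mulrA ler_wpM2r ?L2norm_ge0//.
  apply: le_trans (opnorm_leBC (hk N) u) _.
  by rewrite ler_wpM2r ?L2norm_ge0.
apply: le_trans (ler_wpM2l (L2norm_ge0 u) (hl N v)) _.
have K0 : 0 <= 2 / (1 - 2^-1) :> R by rewrite divr_ge0// subr_ge0 ltW.
move: (2 / (1 - 2^-1)) K0 (2^-1 ^+ N) hN => K K0 x hx.
have -> : L2norm u * (K * x * L2norm v) = x * (K * (L2norm u * L2norm v)) by ring.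
by rewrite ler_wpM2r// !mulr_ge0 ?L2norm_ge0.
Qed.

End Operators.

(** * The translation action and its derivatives *)

Section Translations.
Variables (R : realType) (n : nat).
Local Notation point := (n.-tuple (measurableTypeR R)).
Local Notation H := (L2 R n).
Local Notation op := (L2op R n).
Local Notation Re := (@complex.Re R).
Local Notation cabs := (@ComplexField.Normc.normc R).
Local Open Scope complex_scope.
Local Open Scope quotient_scope.
Local Open Scope ring_scope.
Implicit Types (S T : op) (u v w : H).

Lemma phase1 : phase (fun _ : point => 1 : R[i]).
Proof.
by split=> [k x|||x] /=; rewrite ?expr1n ?expr0n ?addr0; do ?exact: measurable_cst.
Qed.

Lemma phase_expi (j : 'I_n) : phase (fun x : point => expi (tnth x j)).
Proof.
have mt : measurable_fun setT (fun x : point => tnth x j) by exact: measurable_tnth.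
split=> [k x|||x] /=.
- rewrite /expi tnth_mktuple !mxE eqxx andbT.
  case: eqP => _; last by rewrite mulr0 addr0.
  by rewrite mulr1 mulr_natl cosD2pi sinD2pi.
- exact: (measurableT_comp (continuous_measurable_fun (@continuous_cos R)) mt).
- exact: (measurableT_comp (continuous_measurable_fun (@continuous_sin R)) mt).
- exact: cos2Dsin2.
Qed.

Lemma adjointable_wtrans_op phi s : phase phi -> adjointable (wtrans_op phi s : op).
Proof.
move=> phiP; split; last by exists (wtrans_op (cophase phi s) (- s)); exact: wtrans_op_adjoint.
by exists 1 => // u; rewrite L2norm_wtrans_op// mul1r.
Qed.

Lemma V_wtrans s : V s = wtrans_op (fun=> 1) s :> op.
Proof. by apply/funext => u; congr L2_class; apply/funext => x; rewrite mul1r. Qed.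

Lemma V_pi s (f : L2fun R n) : V s (\pi_H f) = \pi_H (wtrans (fun=> 1) s f).
Proof. by rewrite V_wtrans wtrans_op_pi//; exact: phase1. Qed.

Lemma VD s t u : V s (V t u) = V (s + t) u.
Proof.
have p1 := phase1; rewrite -[u]reprK.
rewrite (V_pi t (repr u)) (V_pi s (wtrans _ t _)) (V_pi (s + t) (repr u)).
congr (\pi_H _); apply: val_inj; apply/funext => x /=.
by rewrite !wtransE// !mul1r translate_translate (addrC t).
Qed.

Lemma V0 u : V 0 u = u.
Proof.
rewrite -[u]reprK V_pi; congr (\pi_H _); apply: val_inj; apply/funext => x /=.
by rewrite wtransE ?mul1r ?translate0//; exact: phase1.
Qed.

Lemma V_adjoint s : is_adjoint (V s : op) (V (- s)).
Proof.
have := wtrans_op_adjoint s phase1; rewrite !V_wtrans.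
by rewrite (_ : cophase (fun=> 1) s = fun=> 1)//; apply/funext => x; rewrite /cophase rmorph1.
Qed.

Lemma L2norm_V s u : L2norm (V s u) = L2norm u.
Proof. by rewrite V_wtrans L2norm_wtrans_op//; exact: phase1. Qed.

Lemma is_opinv_uniq T S S' : is_opinv T S -> is_opinv T S' -> S = S'.
Proof.
move=> [_ h2] [h1' _]; apply/funext => u.
have e : T (S' u) = u by rewrite -[LHS]/((T \o S') u) h1'.
by rewrite -{1}e -[LHS]/((S \o T) (S' u)) h2.
Qed.

Lemma opinvE T S : is_opinv T S -> opinv T = S.
Proof.
move=> h; apply: (@is_opinv_uniq T) => //.
by rewrite /opinv; case: xgetP => [x _ //|/(_ S)]; case.
Qed.

Lemma opinv_V s : opinv (V s) = V (- s) :> op.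
Proof. by apply: opinvE; split; apply/funext => u /=; rewrite VD ?subrr ?addNr V0. Qed.

Lemma alphaE s T u : alpha s T u = V s (T (V (- s) u)).
Proof. by rewrite /alpha opinv_V. Qed.

Lemma linV s : linear_op (V s : op).
Proof. exact: is_adjoint_lin (V_adjoint s). Qed.

Lemma alphaM s T S : alpha s (T \o S) = alpha s T \o alpha s S.
Proof. by apply/funext => u; rewrite /= !alphaE VD addNr V0. Qed.


Lemma alphaD s T S : alpha s (T + S) = alpha s T + alpha s S.
Proof.
by apply/funext => u; rewrite -[RHS]/(alpha s T u + alpha s S u) !alphaE -linD//; exact: linV.
Qed.

Lemma alphaZ s a T : alpha s (a *: T) = a *: alpha s T.
Proof.
by apply/funext => u; rewrite -[RHS]/(a *: alpha s T u) !alphaE -linZ//; exact: linV.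
Qed.

Lemma alpha0 T : alpha 0 T = T.
Proof. by apply/funext => u; rewrite alphaE oppr0 !V0. Qed.

Lemma alpha_zero s : alpha s 0 = 0 :> op.
Proof. by rewrite -[X in alpha s X](scale0r (0 : op)) alphaZ scale0r. Qed.

Lemma alpha_idfun s : alpha s idfun = idfun :> op.
Proof. by apply/funext => u; rewrite alphaE VD subrr V0. Qed.

Lemma alpha_opnorm s T c : opnorm_le T c -> opnorm_le (alpha s T) c.
Proof. by move=> h u; rewrite alphaE L2norm_V (le_trans (h _))// L2norm_V. Qed.

Lemma alpha_adjoint s T S : is_adjoint T S -> is_adjoint (alpha s T) (alpha s S).
Proof.
by move=> h u v; rewrite !alphaE V_adjoint h (V_adjoint (- s)) opprK.
Qed.

Lemma adjointable_alpha s T : adjointable T -> adjointable (alpha s T).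
Proof.
move=> [[c c0 h] [S hS]]; split; first by exists c => //; exact: alpha_opnorm.
by exists (alpha s S); exact: alpha_adjoint.
Qed.

Lemma adj_alpha s T : adjointable T -> adj (alpha s T) = alpha s (adj T).
Proof. by move=> h; apply: adjE; apply: alpha_adjoint; exact: is_adjoint_adj. Qed.

Lemma cst1_sq : (fun _ : point => 1 : R[i]) \in @sq_integrable R n.
Proof.
apply: sq_integrableI => //=; try exact: measurable_cst.
under eq_integral do rewrite expr0n addr0 expr1n.
by rewrite integral_cst//= mul1e (@probability_setT _ _ _ (torus_measure R n)) ltry.
Qed.

Lemma V_cst1 s : V s (L2_class (fun=> 1)) = L2_class (fun=> 1) :> H.
Proof.
rewrite V_pi; congr (\pi_H _); apply: val_inj; apply/funext => x /=.
have p1 := phase1; have c1 := cst1_sq.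
by rewrite wtransE// mul1r !val_insubd_L2fun.
Qed.

(** Translations are unitary and fix the constant function 1. *)
Lemma tau_alpha s T : tau (alpha s T) = tau T.
Proof. by rewrite /tau alphaE V_cst1 V_adjoint V_cst1. Qed.

Lemma tauD S T : tau (S + T) = tau S + tau T.
Proof. by rewrite /tau -innerDl. Qed.
Lemma tauZ a T : tau (a *: T) = a * tau T.
Proof. by rewrite /tau -innerZl. Qed.
Lemma tauN T : tau (- T) = - tau T.
Proof. by rewrite -scaleN1r tauZ mulN1r. Qed.
Lemma tau0 : tau (0 : op) = 0.
Proof. by rewrite -[X in tau X](scale0r (0 : op)) tauZ mul0r. Qed.
Lemma tau_sum I (r : seq I) (P : pred I) (F : I -> op) :
  tau (\sum_(i <- r | P i) F i) = \sum_(i <- r | P i) tau (F i).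
Proof. by elim/big_rec2: _ => [|i y1 y2 _ <-]; rewrite ?tau0 ?tauD. Qed.

Lemma tau_le T c : opnorm_le T c -> cabs (tau T) <= c * L2norm (L2_class (fun=> 1) : H) ^+ 2.
Proof.
by move=> h; rewrite (le_trans (cabs_inner_le _ _))// expr2 mulrA ler_wpM2r ?L2norm_ge0.
Qed.

Lemma is_pderiv_uniq (f : 'cV[R]_n -> op) s j D E : is_pderiv f s j D -> is_pderiv f s j E -> D = E.
Proof. exact: op_cvg_uniq. Qed.

Lemma derivationE j T D : is_pderiv (fun s => alpha s T) 0 j D -> derivation j T = D.
Proof.
move=> h; apply: (is_pderiv_uniq _ h).
by rewrite /derivation; case: xgetP => [x _ //|/(_ D)]; case.
Qed.

Lemma opnorm_le_pderivQ (f : 'cV[R]_n -> op) s j D c : is_pderiv f s j D -> opnorm_le D c ->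
  \forall t \near 0^', opnorm_le (f (s + t *: delta_mx j 0) - f s) (`|t| * (1 + c)).
Proof.
move=> h hD; near=> t.
have t0 : t != 0 by near: t; exact: nbhs_dnbhs_neq.
have -> : f (s + t *: delta_mx j 0) - f s =
    t%:C *: ((t^-1)%:C *: (f (s + t *: delta_mx j 0) - f s)).
  by rewrite scalerA -rmorphM/= divff// scale1r.
rewrite -(cabsR t); apply: opnorm_leZ.
rewrite -[X in opnorm_le X](subrK D); apply: opnorm_leD => //.
by near: t; exact: (h 1 ltr01).
Unshelve. all: by end_near. Qed.

Lemma pderiv_cvg (f : 'cV[R]_n -> op) s j D : is_pderiv f s j D -> bounded_op D ->
  op_cvg (fun t : R => f (s + t *: delta_mx j 0)) 0^' (f s).
Proof.
move=> h [c c0 hc] e e0; near=> t.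
have : opnorm_le (f (s + t *: delta_mx j 0) - f s) (`|t| * (1 + c)).
  by near: t; exact: opnorm_le_pderivQ h hc.
apply: opnorm_leW; rewrite -ler_pdivlMr ?ltr_pwDl// ltW//.
by near: t; apply: dnbhs0_lt; rewrite divr_gt0// ltr_pwDl.
Unshelve. all: by end_near. Qed.

Lemma op_cvg_ext I (F : set_system I) (f g : I -> op) T :
  f =1 g -> op_cvg f F T -> op_cvg g F T.
Proof. by move=> /funext ->. Qed.

Lemma is_pderivD (f g : 'cV[R]_n -> op) s j D E : is_pderiv f s j D -> is_pderiv g s j E ->
  is_pderiv (fun s => f s + g s) s j (D + E).
Proof.
move=> hf hg; apply: op_cvg_ext (op_cvgD hf hg) => t.
by rewrite -scalerDr opprD addrACA.
Qed.

Lemma is_pderiv_cst T s j : is_pderiv (fun=> T) s j 0.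
Proof.
rewrite /is_pderiv; rewrite (_ : (fun t => _) = fun=> 0); first exact: op_cvg_cst.
by apply/funext => t; rewrite subrr scaler0.
Qed.

Lemma is_pderiv_sum I (r : seq I) (P : pred I) (F : I -> 'cV[R]_n -> op) (D : I -> op) s j :
  (forall i, P i -> is_pderiv (F i) s j (D i)) ->
  is_pderiv (fun s => \sum_(i <- r | P i) F i s) s j (\sum_(i <- r | P i) D i).
Proof.
move=> h; elim: r => [|i r IH].
  under eq_fun do rewrite big_nil; rewrite big_nil; exact: is_pderiv_cst.
under eq_fun do rewrite big_cons; rewrite big_cons; case: ifPn => // Pi.
exact: (is_pderivD (h i Pi) IH).
Qed.

Lemma is_pderivM (f g : 'cV[R]_n -> op) s j D E :
  adjointable (f s) -> adjointable (g s) -> adjointable D -> adjointable E ->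
  is_pderiv f s j D -> is_pderiv g s j E ->
  is_pderiv (fun s => f s \o g s) s j ((D \o g s) + (f s \o E)).
Proof.
move=> gf gg gD gE hf hg.
pose Q (k : 'cV[R]_n -> op) (t : R) := (t^-1)%:C *: (k (s + t *: delta_mx j 0) - k s).
have h1 : op_cvg (fun t => Q f t \o g (s + t *: delta_mx j 0)) 0^' (D \o g s).
  apply: op_cvgM => //; [exact: adjointable_lin|exact: adjointable_bounded|exact: adjointable_bounded|].
  by apply: (pderiv_cvg hg); exact: adjointable_bounded.
have h2 : op_cvg (fun t => f s \o Q g t) 0^' (f s \o E).
  apply: op_cvgM => //; [exact: adjointable_lin|exact: adjointable_bounded|exact: adjointable_bounded|].
  exact: op_cvg_cst.
rewrite /is_pderiv; apply: op_cvg_ext (op_cvgD h1 h2) => t; apply/funext => u.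
rewrite /Q; set s' := s + _.
rewrite -[LHS]/((t^-1)%:C *: (f s' (g s' u) - f s (g s' u)) + f s ((t^-1)%:C *: (g s' u - g s u))).
rewrite -[RHS]/((t^-1)%:C *: (f s' (g s' u) - f s (g s u))).
by rewrite (linZ (adjointable_lin gf)) (linB (adjointable_lin gf)) -scalerDr addrA subrK.
Qed.

Lemma is_pderiv_adj (f : 'cV[R]_n -> op) s j D : (forall s, adjointable (f s)) -> adjointable D ->
  is_pderiv f s j D -> is_pderiv (fun s => adj (f s)) s j (adj D).
Proof.
move=> gf gD h.
apply: op_cvg_ext (op_cvg_adj (fun t => adjointableZ _ (adjointableB (gf _) (gf _))) gD h) => t.
apply: adjE; have cR : ((t^-1)%:C)^* = (t^-1)%:C by apply: complex_eq; rewrite ?cReJ ?cImJ//= oppr0.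
have := is_adjointZ (t^-1)%:C (is_adjointD (is_adjoint_adj (gf (s + t *: delta_mx j 0)))
  (is_adjointN (is_adjoint_adj (gf s)))).
by rewrite cR.
Qed.

(** The trace is constant along the orbit of T. *)
Lemma tau_pderiv T j D : is_pderiv (fun s => alpha s T) 0 j D -> tau D = 0.
Proof.
move=> h; apply: (@cabs_le_eps _ _ (L2norm (L2_class (fun=> 1) : H) ^+ 2)) => e e0.
have [t ht] := @filter_ex _ _ (@Proper_dnbhs_numFieldType R 0) _ (h e e0).
have := tau_le ht.
rewrite tauD tauZ tauD !tauN !tau_alpha subrr mulr0 sub0r.
by case: (tau D) => a b /=; rewrite !sqrrN.
Qed.

End Translations.

(** * Smooth elements of the noncommutative torus *)

Section NCTorus.
Variables (R : realType) (n : nat) (theta : 'M[R]_n).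
Local Notation op := (L2op R n).
Local Open Scope complex_scope.
Local Open Scope ring_scope.
Implicit Types (S T : op).

Lemma nctorus_adjointable T : nctorus theta T -> adjointable T.
Proof.
elim=> [j|S {}T _ gS _ gT|a {}T _ gT|S {}T _ gS _ gT|S {}T _ gT hS|f {}T _ gf fT].
- exact: (adjointable_wtrans_op (pi *: col j theta) (phase_expi R j)).
- exact: adjointableD.
- exact: adjointableZ.
- exact: adjointableM.
- exact: (is_adjoint_adjointable gT hS).
- exact: adjointable_lim fT.
Qed.

Lemma nctorus_adj T : nctorus theta T -> nctorus theta (adj T).
Proof.
move=> h; apply: (nct_adj h); apply: is_adjoint_adj.
exact: nctorus_adjointable.
Qed.

Lemma nctorusN T : nctorus theta T -> nctorus theta (- T).
Proof. by rewrite -scaleN1r; exact: nct_scale. Qed.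

Lemma Ck_nctorus k f s : Ck theta k f -> nctorus theta (f s).
Proof. by case: k => [|k] []. Qed.
Lemma Ck_adjointable k f s : Ck theta k f -> adjointable (f s).
Proof. by move=> /Ck_nctorus h; exact: nctorus_adjointable. Qed.
Lemma Ck_cvg k f s : Ck theta k f -> op_cvg f (nbhs s) (f s).
Proof. by case: k => [|k] []. Qed.
Lemma CkW k f : Ck theta k.+1 f -> Ck theta k f.
Proof.
elim: k f => [|k IH] f [h1 h2 h3]; split=> // j.
by have [g hg /IH Cg] := h3 j; exists g.
Qed.

Lemma CkD k f g : Ck theta k f -> Ck theta k g -> Ck theta k (fun s => f s + g s).
Proof.
elim: k f g => [|k IH] f g Cf Cg.
  split=> // s; first exact: nct_add (Ck_nctorus s Cf) (Ck_nctorus s Cg).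
  exact: op_cvgD (Ck_cvg s Cf) (Ck_cvg s Cg).
split=> [s|s|j]; first exact: nct_add (Ck_nctorus s Cf) (Ck_nctorus s Cg).
  exact: op_cvgD (Ck_cvg s Cf) (Ck_cvg s Cg).
case: Cf Cg => _ _ /(_ j)[f' hf Cf] [_ _ /(_ j)[g' hg Cg]].
exists (fun s => f' s + g' s); last exact: IH.
by move=> s; exact: is_pderivD.
Qed.

Lemma CkM k f g : Ck theta k f -> Ck theta k g -> Ck theta k (fun s => f s \o g s).
Proof.
have c0 k' f' g' : Ck theta k' f' -> Ck theta k' g' ->
    (forall s, nctorus theta (f' s \o g' s)) /\
    (forall s, op_cvg (fun s => f' s \o g' s) (nbhs s) (f' s \o g' s)).
  move=> Cf Cg; split=> s; first exact: nct_mul (Ck_nctorus s Cf) (Ck_nctorus s Cg).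
  have gf := Ck_adjointable s Cf; have gg := Ck_adjointable s Cg.
  apply: op_cvgM; [exact: adjointable_lin|exact: adjointable_bounded|exact: adjointable_bounded|
    exact: (Ck_cvg s Cf)|exact: (Ck_cvg s Cg)].
elim: k f g => [|k IH] f g Cf Cg; have [h1 h2] := c0 _ _ _ Cf Cg; split=> // j.
have Cf' := CkW Cf; have Cg' := CkW Cg.
case: (Cf) (Cg) => _ _ /(_ j)[f' hf C1] [_ _ /(_ j)[g' hg C2]].
exists (fun s => (f' s \o g s) + (f s \o g' s)); last by apply: CkD; exact: IH.
by move=> s; apply: is_pderivM => //; [exact: Ck_adjointable Cf|exact: Ck_adjointable Cg|
  exact: Ck_adjointable C1|exact: Ck_adjointable C2].
Qed.

Lemma Ck_adj k f : Ck theta k f -> Ck theta k (fun s => adj (f s)).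
Proof.
have c0 k' f' : Ck theta k' f' -> (forall s, nctorus theta (adj (f' s))) /\
    (forall s, op_cvg (fun s => adj (f' s)) (nbhs s) (adj (f' s))).
  move=> Cf; split=> s; first by apply: nctorus_adj; exact: Ck_nctorus Cf.
  apply: op_cvg_adj; [by move=> t; exact: Ck_adjointable Cf|exact: Ck_adjointable Cf|exact: Ck_cvg Cf].
elim: k f => [|k IH] f Cf; have [h1 h2] := c0 _ _ Cf; split=> // j.
case: (Cf) => _ _ /(_ j)[f' hf C1].
exists (fun s => adj (f' s)); last exact: IH.
by move=> s; apply: is_pderiv_adj => // [t|]; [exact: Ck_adjointable Cf|exact: Ck_adjointable C1].
Qed.

Lemma Ck_cst k T : nctorus theta T -> Ck theta k (fun=> T).
Proof.
have N0 : nctorus theta T -> nctorus theta 0 by move=> h; rewrite -(scale0r T); exact: nct_scale.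
elim: k T N0 => [|k IH] T N0 hT; split=> //; do ?by move=> *; exact: op_cvg_cst.
move=> j; exists (fun=> 0) => [s|]; first exact: is_pderiv_cst.
by apply: IH; [|exact: N0].
Qed.

Lemma smoothD S T : smooth_nct theta S -> smooth_nct theta T -> smooth_nct theta (S + T).
Proof.
move=> [hS CS] [hT CT]; split; first exact: nct_add.
by move=> k; under eq_fun do rewrite alphaD; exact: CkD.
Qed.

Lemma smoothM S T : smooth_nct theta S -> smooth_nct theta T -> smooth_nct theta (S \o T).
Proof.
move=> [hS CS] [hT CT]; split; first exact: nct_mul.
by move=> k; under eq_fun do rewrite alphaM; exact: CkM.
Qed.

Lemma smooth_adjointable T : smooth_nct theta T -> adjointable T.
Proof. by move=> [h _]; exact: nctorus_adjointable. Qed.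

Lemma smooth_adj T : smooth_nct theta T -> smooth_nct theta (adj T).
Proof.
move=> sT; have gT := smooth_adjointable sT; case: sT => hT CT; split; first exact: nctorus_adj.
by move=> k; under eq_fun do rewrite -adj_alpha//; exact: Ck_adj.
Qed.

Lemma smooth_idfun : nctorus theta idfun -> smooth_nct theta idfun.
Proof. by move=> h; split=> // k; under eq_fun do rewrite alpha_idfun; exact: Ck_cst. Qed.

Lemma smooth0 : nctorus theta idfun -> smooth_nct theta 0.
Proof.
move=> h; have h0 : nctorus theta 0 by rewrite -(scale0r (idfun : op)); exact: nct_scale.
by split=> // k; under eq_fun do rewrite alpha_zero; exact: Ck_cst.
Qed.

Lemma smooth_sum I (r : seq I) (P : pred I) (F : I -> op) : nctorus theta idfun ->
  (forall i, P i -> smooth_nct theta (F i)) -> smooth_nct theta (\sum_(i <- r | P i) F i).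
Proof. by move=> h hF; apply: big_ind => //; [exact: smooth0|exact: smoothD]. Qed.

Lemma smooth_pderiv T j : smooth_nct theta T ->
  is_pderiv (fun s => alpha s T) 0 j (derivation j T) /\ adjointable (derivation j T).
Proof.
move=> [hT /(_ 1%N)[_ _ /(_ j)[g hg Cg]]].
rewrite (derivationE (hg 0)); split; first exact: hg.
by case: Cg => tg _ _; exact: nctorus_adjointable (tg 0).
Qed.

End NCTorus.

(** * Sylvester equations and square roots *)

Section NearScalar.
Variables (R : realType) (n : nat).
Local Notation H := (L2 R n).
Local Notation op := (L2op R n).
Local Notation Re := (@complex.Re R).
Local Notation cabs := (@ComplexField.Normc.normc R).
Local Open Scope complex_scope.
Local Open Scope ring_scope.
Implicit Types (S T : op) (u v w : H).

Definition rescaled_defect (rho : R) T : op := idfun - rho^-1%:C *: T.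

(** T = rho (1 - y) with y of norm at most q < 1: the quantitative form of
    positivity and invertibility for which Neumann-type iterations converge. *)
Definition near_scalar (rho q : R) T :=
  [/\ 0 < rho, 0 <= q, q < 1 & opnorm_le (rescaled_defect rho T) q].

Lemma defectE rho T u : 0 < rho ->
  T u = rho%:C *: (u - rescaled_defect rho T u).
Proof.
move=> r0; rewrite -[rescaled_defect rho T u]/(u - rho^-1%:C *: T u) subKr.
by rewrite scalerA -rmorphM/= divff ?gt_eqF// scale1r.
Qed.

Lemma near_scalar_alpha s rho q T : near_scalar rho q T -> near_scalar rho q (alpha s T).
Proof.
move=> [r0 q0 q1 h]; split=> //.
have -> : rescaled_defect rho (alpha s T) = alpha s (rescaled_defect rho T).
  by rewrite /rescaled_defect -[- (_ *: T)]scaleN1r alphaD !alphaZ alpha_idfun scaleN1r.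
exact: alpha_opnorm.
Qed.

(** Let r = b^* b, let B bound b and its adjoint, and let C bound v. Then
    |r u| <= B |b u| and |u| = |v r u| <= C B |b u|, so that
    |u - r u / B^2|^2 = |u|^2 - 2 |b u|^2 / B^2 + |r u|^2 / B^4
                     <= |u|^2 - |b u|^2 / B^2 <= (1 - (C B^2)^-2) |u|^2. *)
Lemma near_scalar_positive (b v : op) : adjointable b -> bounded_op v -> v \o (adj b \o b) = idfun ->
  exists rho q, near_scalar rho q (adj b \o b).
Proof.
move=> gb [c c0 hc] vr; have [B0 B00 hB0] := adjointable_bounded gb.
pose B := B0 + 1; pose C := c + 1.
have Bp : 0 < B by rewrite ltr_pwDr.
have Cp : 0 < C by rewrite ltr_pwDr.
have hB : opnorm_le b B by apply: opnorm_leW hB0; rewrite lerDl.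
have hBa : opnorm_le (adj b) B by apply: opnorm_le_adjoint (ltW Bp) (is_adjoint_adj gb) hB.
have hC : opnorm_le v C by apply: opnorm_leW hc; rewrite lerDl.
pose kap := (C * B ^+ 2) ^- 2.
have kap0 : 0 < kap by rewrite invr_gt0 exprn_gt0// mulr_gt0// exprn_gt0.
exists (B ^+ 2), (Num.sqrt (1 - kap)); split.
- by rewrite exprn_gt0.
- exact: sqrtr_ge0.
- by rewrite -[ltRHS]sqrtr1 ltr_sqrt// gtrBl.
move=> u; set r := adj b \o b.
have lb : L2norm u <= C * B * L2norm (b u).
  rewrite -{1}[u]/(idfun u) -vr; apply: le_trans (hC _) _.
  by rewrite -mulrA ler_pM2l//; exact: hBa.
have rule : Re (inner u (r u)) = L2norm (b u) ^+ 2.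
  by rewrite L2norm_sqr -(is_adjoint_adj gb).
have le_r : L2norm (r u) <= B * L2norm (b u) by exact: hBa.
have E : L2norm (rescaled_defect (B ^+ 2) r u) ^+ 2 =
    L2norm u ^+ 2 - 2 / B ^+ 2 * L2norm (b u) ^+ 2 + L2norm (r u) ^+ 2 / B ^+ 4.
  rewrite -[rescaled_defect _ _ _]/(u - (B ^+ 2)^-1%:C *: r u) -scaleNr L2norm_sqrD.
  rewrite -rmorphN L2normZ cabsR innerZr cReMR rule normrN exprMn.
  rewrite ger0_norm ?invr_ge0 ?exprn_ge0 ?ltW//.
  by field; rewrite gt_eqF.
rewrite -(@ler_pXn2r _ 2) ?nnegrE ?mulr_ge0 ?L2norm_ge0 ?sqrtr_ge0// exprMn.
apply: (@le_trans _ _ ((1 - kap) * L2norm u ^+ 2)).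
  rewrite E mulrBl mul1r.
  have h1 : L2norm (r u) ^+ 2 / B ^+ 4 <= L2norm (b u) ^+ 2 / B ^+ 2.
    have -> : L2norm (b u) ^+ 2 / B ^+ 2 = (B * L2norm (b u)) ^+ 2 / B ^+ 4.
      by field; rewrite gt_eqF.
    by rewrite ler_pM2r ?invr_gt0 ?exprn_gt0// ler_pXn2r ?nnegrE ?mulr_ge0 ?L2norm_ge0// ltW.
  have h2 : kap * L2norm u ^+ 2 <= L2norm (b u) ^+ 2 / B ^+ 2.
    have -> : L2norm (b u) ^+ 2 / B ^+ 2 = kap * (C * B * L2norm (b u)) ^+ 2.
      by rewrite /kap; field; rewrite !gt_eqF.
    by rewrite ler_pM2l// ler_pXn2r ?nnegrE ?mulr_ge0 ?L2norm_ge0// ltW.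
  have -> : 2 / B ^+ 2 * L2norm (b u) ^+ 2 = L2norm (b u) ^+ 2 / B ^+ 2 + L2norm (b u) ^+ 2 / B ^+ 2.
    by field; rewrite gt_eqF.
  by lra.
rewrite ler_wpM2r ?sqr_ge0//.
have [k1|/ltW k1] := leP kap 1; first by rewrite sqr_sqrtr// subr_ge0.
by rewrite (le_trans _ (sqr_ge0 _))// subr_le0.
Qed.

Lemma opnorm_attained T : bounded_op T -> exists M, [/\ 0 <= M, opnorm_le T M &
  forall M', 0 <= M' -> opnorm_le T M' -> M <= M'].
Proof.
move=> [c c0 hc]; pose A := [set M : R | 0 <= M /\ opnorm_le T M].
have A0 : A !=set0 by exists c.
have lbA : lbound A 0 by move=> x [].
exists (inf A); split; first exact: lb_le_inf.
- move=> u; have [u0|u0] := eqVneq (L2norm u) 0.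
    by rewrite u0 mulr0 -(mulr0 c) -u0.
  have up : 0 < L2norm u by rewrite lt_def u0 L2norm_ge0.
  rewrite -ler_pdivrMr//; apply: lb_le_inf => // M [_ hM].
  by rewrite ler_pdivrMr.
- by move=> M' M0 hM; apply: ge_inf => //; exists 0.
Qed.

(** With a = rho (1 - y) and b = rho (1 - z) the equation a X + X b = Y reads
    2 X = Y / rho + y X + X z, so the best bound M of X satisfies
    2 M <= c / rho + 2 q M. The case c = 0 is uniqueness. *)
Lemma sylvester_bound rho q a b X Y c : near_scalar rho q a -> near_scalar rho q b ->
  linear_op X -> bounded_op X -> 0 <= c -> opnorm_le Y c -> (a \o X) + (X \o b) = Y ->
  opnorm_le X (c / (2 * rho * (1 - q))).
Proof.
move=> [r0 q0 q1 ha] [_ _ _ hb] lX bX c0 hY XY.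
have [M [M0 hM minM]] := opnorm_attained bX.
apply: (opnorm_leW _ hM).
have p0 : 0 < 1 - q by rewrite subr_gt0.
have p2 : 0 < 2 - q by lra.
have r0' := ltW r0; have p2' := ltW p2.
suff : M <= (c + rho * q * M) / (rho * (2 - q)).
  rewrite ler_pdivlMr ?mulr_gt0// ler_pdivlMr ?mulr_gt0//; nra.
apply: minM.
  by apply: divr_ge0; rewrite ?addr_ge0 ?mulr_ge0.
move=> u.
have e : (2 * rho)%:C *: X u =
    Y u + rho%:C *: (rescaled_defect rho a (X u) + X (rescaled_defect rho b u)).
  rewrite -XY -[((a \o X) + (X \o b)) u]/(a (X u) + X (b u)).
  rewrite (defectE a _ r0) (defectE b u r0) (linZ lX) (linB lX) -!scalerDr.
  by rewrite addrACA !subrK scalerDr mulr_natl mulr2n rmorphD/= scalerDl.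
have h : 2 * rho * L2norm (X u) <= c * L2norm u + rho * (q * L2norm (X u) + M * (q * L2norm u)).
  have -> : 2 * rho * L2norm (X u) = L2norm ((2 * rho)%:C *: X u).
    by rewrite L2normZ cabsR ger0_norm// mulr_ge0// ltW.
  rewrite e (le_trans (L2normD _ _))// lerD//.
  rewrite L2normZ cabsR (ger0_norm r0') (ler_pM2l r0).
  rewrite (le_trans (L2normD _ _))// lerD//.
  by rewrite (le_trans (hM _))// ler_wpM2l.
rewrite mulrAC ler_pdivlMr ?mulr_gt0//.
by move: h; set x := L2norm (X u); set y := L2norm u; lra.
Qed.

Lemma op_cvg_shift (f : nat -> op) T : op_cvg f \oo T -> op_cvg (fun k => f k.+1) \oo T.
Proof.
move=> h e e0; have [N _ hN] := h e e0; exists N => // k /= Nk.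
by apply: hN => /=; exact: leqW.
Qed.

Lemma opnorm_le_lim (f : nat -> op) T c : op_cvg f \oo T ->
  (forall k, opnorm_le (f k) c) -> opnorm_le T c.
Proof.
move=> h hc u; rewrite -subr_le0; apply: (@le0_eps _ _ (L2norm u)) => e e0.
have [k hk] := filter_ex (h e e0).
rewrite lerBlDr addrC -{1}(subKr (f k u) (T u)) (le_trans (L2normB _ _))// lerD//; first exact: hc.
exact: hk.
Qed.

Lemma half_half : 2^-1%:C + 2^-1%:C = 1 :> R[i].
Proof. by rewrite -rmorphD/= (_ : 2^-1 + 2^-1 = 1 :> R)//; field. Qed.

Lemma opnorm_half T c : opnorm_le T (2 * c) -> opnorm_le (2^-1%:C *: T) c.
Proof.
move=> h; apply: opnorm_leW (opnorm_leZ (2^-1%:C) h).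
by rewrite cabsR ger0_norm// mulrA mulVf ?pnatr_eq0// mul1r.
Qed.

Section SylvesterExists.
Variables (rho q : R) (r Y : op).
Hypotheses (nr : near_scalar rho q r) (gr : adjointable r) (gY : adjointable Y).

Let y := rescaled_defect rho r.
Let gy : adjointable y.
Proof. by apply: adjointableB; [exact: adjointable_idfun|exact: adjointableZ]. Qed.

Let Phi (X : op) : op := 2^-1%:C *: (rho^-1%:C *: Y + ((y \o X) + (X \o y))).
Let X_ k : op := iter k Phi 0.

(** With r = rho (1 - y), the equation is the fixed-point problem
    X = (Y / rho + y X + X y) / 2, a contraction of ratio q. *)
Lemma sylvester_exists : exists2 X, adjointable X & (r \o X) + (X \o r) = Y.
Proof.
have [r0 q0 q1 hy] := nr; have [c c0 hc] := adjointable_bounded gY.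
have ly := adjointable_lin gy.
have gX k : adjointable (X_ k).
  elim: k => [|k IH]; first exact: adjointable0.
  by apply/adjointableZ/adjointableD; [exact: adjointableZ|apply: adjointableD; exact: adjointableM].
pose C := rho^-1 * c.
have C0 : 0 <= C by rewrite mulr_ge0// invr_ge0 ltW.
have step k : opnorm_le (X_ k.+1 - X_ k) (C * q ^+ k).
  elim: k => [|k IH].
    rewrite /X_ /= subr0 /Phi expr0 mulr1; apply: opnorm_half.
    have -> : (y \o 0) + (0 \o y) = 0 :> op.
      by apply/funext => u; rewrite -[LHS]/(y 0 + 0) (lin0 ly) addr0.
    rewrite addr0; apply: opnorm_leW (opnorm_leZ _ hc).
    rewrite cabsR ger0_norm ?invr_ge0 ?(ltW r0)//.
    by rewrite -/C mulr_natl mulr2n lerDl.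
  have -> : X_ k.+2 - X_ k.+1 = 2^-1%:C *: ((y \o (X_ k.+1 - X_ k)) + ((X_ k.+1 - X_ k) \o y)).
    rewrite -[X_ k.+2]/(Phi (X_ k.+1)) -[X in _ - X]/(Phi (X_ k)) /Phi -scalerBr.
    congr (_ *: _); rewrite opprD addrACA subrr add0r; apply/funext => u.
    move: (X_ k.+1) (X_ k) => A B.
    rewrite -[LHS]/((y (A u) + A (y u)) - (y (B u) + B (y u))).
    rewrite -[RHS]/(y (A u - B u) + (A (y u) - B (y u))) (linB ly).
    by rewrite opprD addrACA.
  apply: opnorm_half; rewrite mulr_natl mulr2n exprS mulrCA.
  apply: opnorm_leD; first exact: opnorm_leM.
  by rewrite mulrC; apply: opnorm_leM => //; rewrite mulr_ge0 ?exprn_ge0.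
have [X cX _] := op_cvg_geometric C0 q0 q1 step.
have gX' : adjointable X by exact: adjointable_lim cX.
exists X => //.
have XE : X = Phi X.
  apply: (op_cvg_uniq (op_cvg_shift cX)); apply: op_cvgZ; apply: op_cvgD; first exact: op_cvg_cst.
  apply: op_cvgD; (apply: op_cvgM;
    [exact: adjointable_lin|exact: adjointable_bounded|exact: adjointable_bounded| |]) => //;
    exact: op_cvg_cst.
apply/funext => u; rewrite -[LHS]/(r (X u) + X (r u)).
rewrite (defectE r _ r0) (defectE r u r0) (linZ (adjointable_lin gX')) (linB (adjointable_lin gX')) -/y.
have : X u + X u = rho^-1%:C *: Y u + (y (X u) + X (y u)).
  rewrite {1 2}XE -[Phi X u]/(2^-1%:C *: (rho^-1%:C *: Y u + (y (X u) + X (y u)))).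
  by rewrite -scalerDl half_half scale1r.
move/(congr1 (fun z => z - (y (X u) + X (y u)))); rewrite addrK opprD addrACA => e.
by rewrite -scalerDr e scalerA -rmorphM/= divff ?gt_eqF// scale1r.
Qed.

End SylvesterExists.

Section Sqrt.
Variables (theta : 'M[R]_n) (rho q : R) (T : op).
Hypotheses (nT : near_scalar rho q T) (tT : nctorus theta T) (sT : adj T = T).
Hypothesis id_t : nctorus theta idfun.

Let x := rescaled_defect rho T.
Let tx : nctorus theta x.
Proof. by apply: nct_add => //; apply: nctorusN; exact: nct_scale. Qed.

Let y_ k : op := iter k (fun y => 2^-1%:C *: (x + (y \o y))) 0.

(** With T = rho (1 - x), the operator rho^{1/2} (1 - y) is a square root of T
    as soon as y = (x + y^2) / 2, and the right-hand side is a contraction of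
    ratio q on the ball of radius q. The root is near a scalar again, so a
    fourth root can be taken in the same way. *)
Lemma sqrt_exists : exists r, [/\ nctorus theta r, adj r = r, r \o r = T &
  near_scalar (Num.sqrt rho) q r].
Proof.
have [r0 q0 q1 hx] := nT.
have gT := nctorus_adjointable tT; have gx := nctorus_adjointable tx.
have ty k : nctorus theta (y_ k).
  elim: k => [|k IH]; first by rewrite /y_ /= -(scale0r x); exact: nct_scale.
  by apply: nct_scale; apply: nct_add => //; exact: nct_mul.
have gy k := nctorus_adjointable (ty k).
have conjR (a : R) : (a%:C)^* = a%:C by apply: complex_eq; rewrite ?cReJ ?cImJ//= oppr0.
have sx : is_adjoint x x.
  have := is_adjointD (is_adjoint_idfun (n := n)) (is_adjointN (is_adjointZ (rho^-1%:C) (is_adjoint_adj gT))).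
  by rewrite sT conjR.
have sy k : is_adjoint (y_ k) (y_ k).
  elim: k => [|k IH]; first exact: is_adjoint0.
  by have := is_adjointZ (2^-1%:C) (is_adjointD sx (is_adjointM IH IH)); rewrite conjR.
have hy k : opnorm_le (y_ k) q.
  elim: k => [|k IH]; first by apply: opnorm_leW (@opnorm_le00 _ _).
  apply: opnorm_half; rewrite mulr_natl mulr2n; apply: opnorm_leD => //.
  by apply: opnorm_leW (opnorm_leM q0 IH IH); rewrite ler_piMl// ltW.
have step k : opnorm_le (y_ k.+1 - y_ k) (q * q ^+ k).
  elim: k => [|k IH].
    by rewrite expr0 mulr1 subr0; exact: (hy 1%N).
  have -> : y_ k.+2 - y_ k.+1 =
      2^-1%:C *: ((y_ k.+1 \o (y_ k.+1 - y_ k)) + ((y_ k.+1 - y_ k) \o y_ k)).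
    rewrite -[y_ k.+2]/(2^-1%:C *: (x + (y_ k.+1 \o y_ k.+1))).
    rewrite -[X in _ - X]/(2^-1%:C *: (x + (y_ k \o y_ k))) -scalerBr.
    congr (_ *: _); rewrite opprD addrACA subrr add0r; apply/funext => u.
    have := linB (adjointable_lin (gy k.+1)); move: (y_ k.+1) (y_ k) => A B lA.
    rewrite -[LHS]/(A (A u) - B (B u)) -[RHS]/(A (A u - B u) + (A (B u) - B (B u))).
    by rewrite lA addrA subrK.
  apply: opnorm_half; rewrite mulr_natl mulr2n exprS.
  apply: opnorm_leD; first exact: opnorm_leM.
  by rewrite [X in opnorm_le _ X]mulrC; apply: opnorm_leM => //; rewrite mulr_ge0 ?exprn_ge0.
have [y cy _] := op_cvg_geometric q0 q0 q1 step.
have t_y : nctorus theta y by exact: nct_lim cy.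
have g_y := nctorus_adjointable t_y; have l_y := adjointable_lin g_y.
have n_y : opnorm_le y q by exact: opnorm_le_lim cy hy.
have s_y : adj y = y.
  apply: (op_cvg_uniq _ cy).
  by apply: (op_cvg_ext _ (op_cvg_adj gy g_y cy)) => k; exact: adjE.
have yE : y = 2^-1%:C *: (x + (y \o y)).
  apply: (op_cvg_uniq (op_cvg_shift cy)); apply: op_cvgZ; apply: op_cvgD; first exact: op_cvg_cst.
  by apply: op_cvgM => //; exact: adjointable_bounded.
have sr0 : 0 < Num.sqrt rho by rewrite sqrtr_gt0.
pose r : op := (Num.sqrt rho)%:C *: (idfun - y).
exists r; split.
- by apply: nct_scale; apply: nct_add => //; exact: nctorusN.
- apply: adjE; have := is_adjointZ (Num.sqrt rho)%:C
    (is_adjointD (is_adjoint_idfun (n := n)) (is_adjointN (is_adjoint_adj g_y))).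
  by rewrite s_y conjR.
- apply/funext => u; rewrite -[LHS]/(r (r u)).
  pose sr := (Num.sqrt rho)%:C.
  rewrite -[r (r u)]/(sr *: (sr *: (u - y u) - y (sr *: (u - y u)))) (linZ l_y) (linB l_y).
  rewrite -scalerBr scalerA -rmorphM/= -expr2 sqr_sqrtr ?ltW// (defectE T u r0) -/x.
  congr (_ *: _).
  have : y u + y u = x u + y (y u).
    rewrite {1 2}yE -[(2^-1%:C *: (x + (y \o y))) u]/(2^-1%:C *: (x u + y (y u))).
    by rewrite -scalerDl half_half scale1r.
  move=> e; have -> : x u = y u + y u - y (y u) by rewrite e addrK.
  by rewrite -addrA -opprD addrA.
- split=> //; rewrite /rescaled_defect /r scalerA -rmorphM/= mulVf ?gt_eqF// scale1r.
  by rewrite subKr.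
Qed.

End Sqrt.

End NearScalar.

(** * The square root of the density *)

Section SquareRoot.
Variables (R : realType) (n : nat) (theta : 'M[R]_n).
Local Notation op := (L2op R n).
Local Open Scope complex_scope.
Local Open Scope ring_scope.
Implicit Types (S T : op).

Lemma nctorus_idfun nu : smooth_pos_inv theta nu -> nctorus theta idfun.
Proof. by move=> [[tn _] _ [v [tv _] [<- _]]]; exact: nct_mul. Qed.

Lemma positive_adj a : positive theta a -> adj a = a.
Proof.
move=> [b /nctorus_adjointable gb ->].
by rewrite adjM ?adjK//; exact: adjointable_adj.
Qed.

Variables (nu : op) (hnu : smooth_pos_inv theta nu).

Lemma opinvP : is_opinv nu (opinv nu) /\ smooth_nct theta (opinv nu).
Proof. by case: hnu => _ _ [v sv iv]; rewrite (opinvE iv). Qed.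

(** Positivity of the root asks for b in the algebra with b^* b equal to it:
    b is a self-adjoint fourth root of nu. *)
Lemma opsqrtP : positive theta (opsqrt theta nu) /\ opsqrt theta nu \o opsqrt theta nu = nu.
Proof.
have idt := nctorus_idfun hnu.
case: (hnu) => [[tn _] pn [v [tv _] [_ vn]]].
have sn := positive_adj pn; have [b tb nb] := pn.
have [rho [q nq]] : exists rho q, near_scalar rho q nu.
  rewrite nb; apply: (@near_scalar_positive _ _ b v); first exact: nctorus_adjointable tb.
    by apply: adjointable_bounded; exact: nctorus_adjointable tv.
  by rewrite -nb.
have [r [tr sr rr nr]] := sqrt_exists nq tn sn idt.
(* r is the square root of nu, and b' the square root of r *)
have [b' [tb' sb' bb' _]] := sqrt_exists nr tr sr idt.
have ex : positive theta r /\ r \o r = nu by split=> //; exists b'; rewrite // sb' bb'.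
by rewrite /opsqrt; case: xgetP => [x _ //|/(_ r)]; case.
Qed.

Local Notation r := (opsqrt theta nu).

Lemma opsqrt_nctorus : nctorus theta r.
Proof. by have [[b tb ->] _] := opsqrtP; apply: nct_mul => //; exact: nctorus_adj. Qed.

Lemma opsqrt_adjointable : adjointable r. Proof. exact: nctorus_adjointable opsqrt_nctorus. Qed.

Lemma opsqrt_adj : adj r = r. Proof. by have [/positive_adj] := opsqrtP. Qed.

Lemma opsqrt_sqr u : r (r u) = nu u.
Proof. by have [_ {3}<-] := opsqrtP. Qed.

Lemma opsqrt_near_scalar : exists rho q, near_scalar rho q r.
Proof.
have [[_ vn] sv] := opinvP; have [[b tb rb] rr] := opsqrtP.
rewrite rb; apply: (@near_scalar_positive _ _ b (opinv nu \o r)).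
- exact: nctorus_adjointable tb.
- by apply: adjointable_bounded; apply: adjointableM; [exact: smooth_adjointable sv|exact: opsqrt_adjointable].
- by rewrite -rb -compA rr.
Qed.

(** With r the square root, K = r T - T r satisfies r K + K r = r^2 T - T r^2 = 0,
    a Sylvester equation whose only solution is 0. *)
Lemma commute_opsqrt T : adjointable T -> nu \o T = T \o nu -> forall u, r (T u) = T (r u).
Proof.
move=> gT cT; have [rho [q nr]] := opsqrt_near_scalar.
have gr := opsqrt_adjointable; have lr := adjointable_lin gr; have lT := adjointable_lin gT.
have gK : adjointable ((r \o T) - (T \o r)) by apply: adjointableB; exact: adjointableM.
have h : opnorm_le ((r \o T) - (T \o r)) (0 / (2 * rho * (1 - q))).
  apply: (sylvester_bound nr nr (adjointable_lin gK) (adjointable_bounded gK) (lexx 0) (@opnorm_le00 _ _)).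
  apply/funext => u.
  rewrite -[LHS]/(r (r (T u) - T (r u)) + (r (T (r u)) - T (r (r u)))) (linB lr).
  rewrite addrA subrK !opsqrt_sqr -[nu (T u)]/((nu \o T) u) cT.
  exact: subrr.
move=> u; apply/eqP; rewrite -subr_eq0; apply/eqP/L2norm_le0.
by apply: le_trans (h u) _; rewrite !mul0r.
Qed.

(** Differentiating r_s^2 = nu_s at 0 suggests the solution D of r D + D r = N,
    where N is the derivative of nu. The difference quotient Q of r_s solves
    r_s Q + Q r = (nu_s - nu) / t, so Q - D solves a Sylvester equation with
    right-hand side (nu_s - nu) / t - N - (r_s - r) D, and this tends to 0. *)
Lemma opsqrt_pderiv j : exists2 D, adjointable D & is_pderiv (fun s => alpha s r) 0 j D.
Proof.
have [rho [q nr]] := opsqrt_near_scalar; have [rho0 q0 q1 _] := nr.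
have gr := opsqrt_adjointable.
have [dnu gdnu] := smooth_pderiv j (let: And3 s _ _ := hnu in s).
set N := derivation j nu in dnu gdnu.
have [D gD DE] := sylvester_exists nr gr gdnu.
exists D => // e e0.
pose K := 2 * rho * (1 - q).
have K0 : 0 < K by rewrite !mulr_gt0// subr_gt0.
have [d d0 hd] := adjointable_bounded gD.
have d10 : 0 < d + 1 by rewrite ltr_pwDr.
(* (e1 + e2 / K * (d + 1)) / K = e / 2 + e / 2 *)
pose e1 := e * K / 2; pose e2 := e * K / 2 * K / (d + 1).
have e10 : 0 < e1 by rewrite divr_gt0// mulr_gt0.
have e20 : 0 < e2 by rewrite divr_gt0// mulr_gt0.
apply: filterS2 (dnu e1 e10) (pderiv_cvg dnu (adjointable_bounded gdnu) e20) => t h1 h2.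
set s := 0 + t *: delta_mx j 0 in h1 h2 *.
rewrite !alpha0 in h1 h2 *.
have gs := adjointable_alpha s gr; have ls := adjointable_lin gs.
have ns := near_scalar_alpha s nr.
have asq u : alpha s r (alpha s r u) = alpha s nu u.
  rewrite -[LHS]/((alpha s r \o alpha s r) u) -alphaM; congr (alpha s _ _).
  by apply/funext => w; exact: opsqrt_sqr.
have gX : adjointable (alpha s r - r) by exact: adjointableB.
have hX : opnorm_le (alpha s r - r) (e2 / K).
  apply: (sylvester_bound ns nr (adjointable_lin gX) (adjointable_bounded gX) (ltW e20) h2).
  apply/funext => u; rewrite -[LHS]/(alpha s r (alpha s r u - r u) + (alpha s r (r u) - r (r u))).
  by rewrite (linB ls) addrA subrK asq opsqrt_sqr.
set Q := t^-1%:C *: (alpha s r - r).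
have gQ : adjointable Q by exact: adjointableZ.
have gZ : adjointable (Q - D) by exact: adjointableB.
have hY : opnorm_le ((t^-1%:C *: (alpha s nu - nu) - N) - ((alpha s r - r) \o D)) (e1 + e2 / K * (d + 1)).
  apply: opnorm_leB => //; apply: opnorm_leM => //; first by rewrite divr_ge0// ltW.
  by apply: opnorm_leW hd; rewrite lerDl.
have -> : e = (e1 + e2 / K * (d + 1)) / K.
  by rewrite /e1 /e2; field; rewrite !gt_eqF.
apply: (sylvester_bound ns nr (adjointable_lin gZ) (adjointable_bounded gZ) _ hY).
  by apply: addr_ge0; [exact: ltW|apply: mulr_ge0; [apply: divr_ge0|]; exact: ltW].
apply/funext => u.
rewrite -[LHS]/(alpha s r (t^-1%:C *: (alpha s r u - r u) - D u) +
  (t^-1%:C *: (alpha s r (r u) - r (r u)) - D (r u))).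
rewrite -[RHS]/(t^-1%:C *: (alpha s nu u - nu u) - N u - (alpha s r (D u) - r (D u))).
have -> : N u = r (D u) + D (r u) by rewrite -DE.
rewrite (linB ls) (linZ ls) (linB ls) asq opsqrt_sqr.
rewrite addrACA -scalerDr (addrA (_ - _)) subrK -[RHS]addrA; congr (_ + _).
by rewrite -!opprD (addrC (r _)) -addrA (addrCA (r _)) subrr addr0 addrC.
Qed.

End SquareRoot.

(** * Derivations and the trace *)

Section Differentiable.
Variables (R : realType) (n : nat) (theta : 'M[R]_n).
Local Notation op := (L2op R n).
Local Open Scope complex_scope.
Local Open Scope ring_scope.
Implicit Types (S T : op).

Definition differentiable_op j T := [/\ adjointable T, adjointable (derivation j T) &
  is_pderiv (fun s => alpha s T) 0 j (derivation j T)].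

Lemma differentiable_opI j T D : adjointable T -> adjointable D ->
  is_pderiv (fun s => alpha s T) 0 j D -> differentiable_op j T /\ derivation j T = D.
Proof. by move=> gT gD h; rewrite /differentiable_op (derivationE h). Qed.

Lemma smooth_differentiable j T : smooth_nct theta T -> differentiable_op j T.
Proof. by move=> sT; have [h1 h2] := smooth_pderiv j sT; split=> //; exact: smooth_adjointable sT. Qed.

Lemma opsqrt_differentiable nu j : smooth_pos_inv theta nu -> differentiable_op j (opsqrt theta nu).
Proof.
move=> hnu; have [D gD hD] := opsqrt_pderiv hnu j.
by have [] := differentiable_opI (opsqrt_adjointable hnu) gD hD.
Qed.

Lemma derivationM j S T : differentiable_op j S -> differentiable_op j T ->
  differentiable_op j (S \o T) /\
  derivation j (S \o T) = (derivation j S \o T) + (S \o derivation j T).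
Proof.
move=> [gS gdS hS] [gT gdT hT]; apply: differentiable_opI; first exact: adjointableM.
  by apply: adjointableD; exact: adjointableM.
have := is_pderivM (adjointable_alpha 0 gS) (adjointable_alpha 0 gT) gdS gdT hS hT.
by rewrite !alpha0 (_ : (fun s => _) = fun s => alpha s (S \o T))//; apply/funext => s; rewrite alphaM.
Qed.

Lemma derivation_adj j T : differentiable_op j T ->
  differentiable_op j (adj T) /\ derivation j (adj T) = adj (derivation j T).
Proof.
move=> [gT gdT hT]; apply: differentiable_opI; [exact: adjointable_adj|exact: adjointable_adj|].
have := is_pderiv_adj (fun s => adjointable_alpha s gT) gdT hT.
by rewrite (_ : (fun s => _) = fun s => alpha s (adj T))//; apply/funext => s; rewrite adj_alpha.
Qed.

Lemma alpha_sum s I (r : seq I) (P : pred I) (F : I -> op) :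
  alpha s (\sum_(i <- r | P i) F i) = \sum_(i <- r | P i) alpha s (F i).
Proof. by elim/big_rec2: _ => [|i y1 y2 _ <-]; rewrite ?alpha_zero ?alphaD. Qed.

Lemma derivation_sum j I (r : seq I) (P : pred I) (F : I -> op) :
  (forall i, P i -> differentiable_op j (F i)) ->
  derivation j (\sum_(i <- r | P i) F i) = \sum_(i <- r | P i) derivation j (F i).
Proof.
move=> h; apply: derivationE.
rewrite (_ : (fun s => _) = fun s => \sum_(i <- r | P i) alpha s (F i)).
  by apply: is_pderiv_sum => i /h[].
by apply/funext => s; rewrite alpha_sum.
Qed.

Lemma tau_by_parts j S T : differentiable_op j S -> differentiable_op j T ->
  tau (S \o derivation j T) = - tau (derivation j S \o T).
Proof.
move=> hS hT; have [[_ _ h] E] := derivationM hS hT.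
have := tau_pderiv h; rewrite E tauD => /eqP; rewrite addrC addr_eq0 => /eqP.
exact.
Qed.

End Differentiable.

(** * Matrices of operators and the inverse metric *)

Section OperatorMatrices.
Variables (R : realType) (n : nat).
Local Notation H := (L2 R n).
Local Notation op := (L2op R n).
Local Open Scope ring_scope.
Implicit Types (A B : 'M[op]_n) (x : 'I_n -> H).

Lemma op_sumE I (r : seq I) (P : pred I) (F : I -> op) u :
  (\sum_(i <- r | P i) F i) u = \sum_(i <- r | P i) F i u.
Proof. by elim/big_rec2: _ => // i y1 y2 _ <-. Qed.

(** Acting on H^n turns identities between inverse matrices into identities
    between maps. *)
Definition mxact A x : 'I_n -> H := fun i => \sum_k A i k (x k).

Lemma opmx_mulE A B i j u : opmx_mul A B i j u = mxact A (fun k => B k j u) i.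
Proof. by rewrite mxE op_sumE. Qed.

Lemma opmx1E i j u : opmx1 R n i j u = if i == j then u else 0.
Proof. by rewrite mxE; case: eqP. Qed.

Lemma sum_delta (F : 'I_n -> H) i : \sum_k (if i == k then F k else 0) = F i.
Proof. by rewrite (bigD1 i)//= eqxx big1 ?addr0// => k; rewrite eq_sym => /negbTE ->. Qed.

Lemma mxactK A B : (forall i j, linear_op (A i j)) -> opmx_mul A B = opmx1 R n ->
  forall x, mxact A (mxact B x) =1 x.
Proof.
move=> lA AB x i; rewrite /mxact.
under eq_bigr do rewrite (lin_sum (lA _ _)).
rewrite exchange_big /= -[RHS](sum_delta x).
apply: eq_bigr => l _; rewrite -opmx1E -AB opmx_mulE; exact: eq_bigr.
Qed.

(** The inverse picked by [opmxinv] might have non-linear entries; applying the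
    linear matrix B on the left identifies it with B. *)
Lemma opmxinvE A B : (forall i j, linear_op (A i j)) -> (forall i j, linear_op (B i j)) ->
  is_opmxinv A B -> opmxinv A = B.
Proof.
move=> lA lB [AB BA]; have : is_opmxinv A (opmxinv A).
  by rewrite /opmxinv; case: xgetP => [x _ //|/(_ B)]; case.
move=> [AB' _]; apply/matrixP => i j; apply/funext => u.
rewrite -[LHS](mxactK lB BA (fun k => opmxinv A k j u)).
rewrite -[RHS](mxactK lB BA (fun k => B k j u)).
by apply: eq_bigr => k _; congr (B i k _); rewrite -!opmx_mulE AB AB'.
Qed.

Lemma opmx_adjM A B : (forall i j, adjointable (A i j)) -> (forall i j, adjointable (B i j)) ->
  opmx_adj (opmx_mul A B) = opmx_mul (opmx_adj B) (opmx_adj A).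
Proof.
move=> gA gB; apply/matrixP => i j; rewrite !mxE adj_sum => [|k _]; last exact: adjointableM.
by apply: eq_bigr => k _; rewrite adjM// !mxE.
Qed.

Lemma opmx_adjK A : (forall i j, adjointable (A i j)) -> opmx_adj (opmx_adj A) = A.
Proof. by move=> gA; apply/matrixP => i j; rewrite !mxE adjK. Qed.

Lemma opmx_adj1 : opmx_adj (opmx1 R n) = opmx1 R n.
Proof.
apply/matrixP => i j; rewrite !mxE eq_sym; case: eqP => _; apply: adjE;
  [exact: is_adjoint_idfun|exact: is_adjoint0].
Qed.

End OperatorMatrices.

Section Metric.
Variables (R : realType) (n : nat) (theta : 'M[R]_n).
Local Notation op := (L2op R n).
Local Open Scope ring_scope.
Variables (h : 'M[op]_n) (hh : GLplus theta h).
Local Notation g := (opmxinv h).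

Lemma GLplus_smooth i j : smooth_nct theta (h i j).
Proof. by case: hh => /(_ i j). Qed.
Lemma GLplus_adjointable i j : adjointable (h i j).
Proof. exact: smooth_adjointable (GLplus_smooth i j). Qed.
Lemma GLplus_lin i j : linear_op (h i j).
Proof. exact: adjointable_lin (GLplus_adjointable i j). Qed.

Lemma GLplus_adj : opmx_adj h = h.
Proof.
case: hh => _ [B tB hB] _.
have gB i j : adjointable (B i j) by exact: nctorus_adjointable (tB i j).
have gB' i j : adjointable (opmx_adj B i j) by rewrite mxE; exact: adjointable_adj.
by rewrite hB opmx_adjM// opmx_adjK.
Qed.

Lemma opmxinvP : (forall i j, smooth_nct theta (g i j)) /\ is_opmxinv h g.
Proof.
case: (hh) => _ _ [B sB iB]; rewrite (@opmxinvE _ _ h B)//; first exact: GLplus_lin.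
by move=> i j; apply: adjointable_lin; exact: smooth_adjointable (sB i j).
Qed.

Lemma opmxinv_adjointable i j : adjointable (g i j).
Proof. have [sg _] := opmxinvP; exact: smooth_adjointable (sg i j). Qed.
Lemma opmxinv_lin i j : linear_op (g i j).
Proof. exact: adjointable_lin (opmxinv_adjointable i j). Qed.

Lemma opmxinv_adj : opmx_adj g = g.
Proof.
have [sg [hg gh]] := opmxinvP; apply/esym/opmxinvE.
- exact: GLplus_lin.
- by move=> i j; rewrite mxE; apply: adjointable_lin; apply: adjointable_adj; exact: opmxinv_adjointable.
- split.
    by rewrite -{1}GLplus_adj -opmx_adjM ?gh ?opmx_adj1//; [exact: opmxinv_adjointable|exact: GLplus_adjointable].
  by rewrite -{2}GLplus_adj -opmx_adjM ?hg ?opmx_adj1//; [exact: GLplus_adjointable|exact: opmxinv_adjointable].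
Qed.

Lemma adj_opmxinv i j : adj (g i j) = g j i.
Proof. by rewrite -[in RHS]opmxinv_adj mxE. Qed.

Lemma opmxinvK x : mxact g (mxact h x) =1 x.
Proof. by have [_ [_ gh]] := opmxinvP; apply: mxactK => //; exact: opmxinv_lin. Qed.
Lemma opmxinvKV x : mxact h (mxact g x) =1 x.
Proof. by have [_ [hg _]] := opmxinvP; apply: mxactK => //; exact: GLplus_lin. Qed.

(** The matrix h sends the vector of the nu (g l j u), l < n, to the vector with
    nu u in position j and 0 elsewhere. *)
Lemma commute_opmxinv nu : adjointable nu -> (forall i j, nu \o h i j = h i j \o nu) ->
  forall i j, nu \o g i j = g i j \o nu.
Proof.
move=> gnu c i j; apply/funext => u; have lnu := adjointable_lin gnu.
rewrite -[LHS](opmxinvK (fun l => nu (g l j u)) i).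
have e k : mxact h (fun l => nu (g l j u)) k = if k == j then nu u else 0.
  have -> : mxact h (fun l => nu (g l j u)) k = nu (mxact h (fun l => g l j u) k).
    rewrite /mxact (lin_sum lnu); apply: eq_bigr => l _.
    by rewrite -[LHS]/((h k l \o nu) (g l j u)) -c.
  have [_ [hg _]] := opmxinvP; rewrite -opmx_mulE hg opmx1E.
  by case: eqP => // _; exact: lin0.
rewrite /mxact; under eq_bigr do rewrite -/(mxact h _ _) e.
rewrite (bigD1 j)//= eqxx big1 ?addr0// => k /negbTE ->.
exact: lin0 (opmxinv_lin _ _).
Qed.

End Metric.

(** * Differential forms and dual vector fields *)

Section Forms.
Variables (R : realType) (n : nat) (theta : 'M[R]_n).
Local Notation op := (L2op R n).
Local Open Scope ring_scope.
Hypothesis idt : nctorus theta idfun.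

Lemma vfield_basis j : vfield theta (@vf_basis R n j).
Proof.
by move=> i; rewrite /vf_basis; case: eqP => _; [exact: smooth_idfun|exact: smooth0].
Qed.

Lemma coef_smooth w j : form1 theta w -> smooth_nct theta (coef w j).
Proof. by move=> [ws _ _]; apply: ws; exact: vfield_basis. Qed.

Lemma coef_d (u : op) i : coef (d u) i = derivation i u.
Proof.
apply/funext => v; rewrite /coef /d.
have -> : (\sum_k form_mul (dual_basis k) (derivation k u)) (@vf_basis R n i) =
    \sum_k form_mul (dual_basis k) (derivation k u) (@vf_basis R n i).
  by elim/big_rec2: _ => // k y1 y2 _ <-.
rewrite op_sumE (bigD1 i)//= big1 ?addr0 => [|k /negbTE ki].
  by rewrite /form_mul /dual_basis /vf_basis/= eqxx.
by rewrite /form_mul /dual_basis /vf_basis/= ki.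
Qed.

Lemma form1_sum w : form1 theta w -> forall Y, vfield theta Y ->
  w Y = \sum_i (Y i \o coef w i).
Proof.
move=> [_ wD wZ] Y sY.
have v0 : vfield theta (0 : 'I_n -> op) by move=> i; exact: smooth0.
have w0 : w 0 = 0.
  by have := wD 0 0 v0 v0; rewrite addr0 => /eqP; rewrite -subr_eq0 opprD addrA subrr sub0r oppr_eq0 => /eqP.
have sYb i : vfield theta (vf_scale (Y i) (@vf_basis R n i)).
  by move=> k; apply: smoothM; [exact: sY|exact: vfield_basis].
have {1}-> : Y = \sum_i vf_scale (Y i) (@vf_basis R n i).
  apply/funext => k; apply/funext => u.
  have -> : (\sum_i vf_scale (Y i) (@vf_basis R n i)) k = \sum_i vf_scale (Y i) (@vf_basis R n i) k.
    by elim/big_rec2: _ => // i y1 y2 _ <-.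
  rewrite op_sumE (bigD1 k)//= big1 ?addr0 => [|i ik].
    by rewrite /vf_scale /vf_basis/= eqxx.
  rewrite /vf_scale /vf_basis/= eq_sym (negbTE ik).
  exact: lin0 (adjointable_lin (smooth_adjointable (sY i))).
suff [] : vfield theta (\sum_i vf_scale (Y i) (@vf_basis R n i)) /\
    w (\sum_i vf_scale (Y i) (@vf_basis R n i)) = \sum_i (Y i \o coef w i) by [].
apply: (big_rec2 (fun a b => vfield theta a /\ w a = b)) => [|i y1 y2 _ [v1 e1]]; first by [].
split; first by move=> k; apply: smoothD; [exact: sYb|exact: v1].
by rewrite wD// e1 wZ//; exact: vfield_basis.
Qed.

Variables (h : 'M[op]_n) (hh : GLplus theta h).
Local Notation g := (opmxinv h).

(** A field X dual to w satisfies w_i = sum_j h_ij (X^j)^* on the basis; solving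
    for X with the inverse of h gives the formula. The same computation shows
    that the formula defines a field dual to w. *)
Lemma form_vfE w : form1 theta w -> forall k, form_vf theta h w k = \sum_i (adj (coef w i) \o g i k).
Proof.
move=> fw; set X := form_vf theta h w.
have gw i : adjointable (coef w i) by exact: smooth_adjointable (coef_smooth i fw).
have sg i j : smooth_nct theta (g i j) by have [] := opmxinvP hh.
have adjX0 k : adj (\sum_i (adj (coef w i) \o g i k)) = \sum_i (g k i \o coef w i).
  rewrite adj_sum => [|i _]; last first.
    by apply: adjointableM; [exact: adjointable_adj|exact: smooth_adjointable (sg _ _)].
  apply: eq_bigr => i _; rewrite adjM; [|exact: adjointable_adj|exact: smooth_adjointable (sg _ _)].
  by rewrite adjK// (adj_opmxinv hh).
have [vX eX] : vfield theta X /\ forall Y, vfield theta Y -> w Y = metric h Y X.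
  rewrite /X /form_vf; case: xgetP => [Z _ //|].
  move=> /(_ (fun k => \sum_i (adj (coef w i) \o g i k))); case; split.
    move=> k; apply: smooth_sum => // i _; apply: smoothM => //.
    by apply: smooth_adj; exact: coef_smooth.
  move=> Y sY; rewrite (form1_sum fw sY) /metric; apply: eq_bigr => i _.
  apply/funext => u; rewrite op_sumE /=.
  have lY := adjointable_lin (smooth_adjointable (sY i)).
  rewrite -{1}(opmxinvKV hh (fun l => coef w l u) i) /mxact (lin_sum lY).
  by apply: eq_bigr => j _; rewrite adjX0 op_sumE.
have gX k : adjointable (X k) by exact: smooth_adjointable (vX k).
move=> k; rewrite -[LHS]adjK// -[RHS]adjK; last first.
  apply: adjointable_sum => i _.
  by apply: adjointableM; [exact: adjointable_adj|exact: smooth_adjointable (sg _ _)].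
congr adj; rewrite adjX0; apply/funext => u; rewrite op_sumE.
rewrite -[LHS](opmxinvK hh (fun l => adj (X l) u) k); apply: eq_bigr => i _ /=.
congr (g k i _); rewrite /coef eX; last exact: vfield_basis.
rewrite /metric op_sumE (bigD1 i)//= [X in _ + X]big1 ?addr0 => [|l li].
  by rewrite op_sumE; apply: eq_bigr => j _; rewrite /vf_basis/= eqxx.
by rewrite op_sumE big1// => j _; rewrite /vf_basis/= (negbTE li).
Qed.

End Forms.

(** * The divergence operator *)

Section Divergence.
Variables (R : realType) (n : nat) (theta : 'M[R]_n).
Local Notation op := (L2op R n).
Local Open Scope ring_scope.
Variables (h : 'M[op]_n) (hh : GLplus theta h) (nu : op) (hnu : smooth_pos_inv theta nu).
Variables (w : ('I_n -> op) -> op) (fw : form1 theta w).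
Local Notation g := (opmxinv h).
Local Notation r := (opsqrt theta nu).

Definition flux i j : op := r \o g i j \o r \o coef w j.

Let coefS j : smooth_nct theta (coef w j).
Proof. by apply: coef_smooth fw; exact: nctorus_idfun hnu. Qed.
Let gS i j : smooth_nct theta (g i j). Proof. by have [] := opmxinvP hh. Qed.

Lemma flux_differentiable i j : differentiable_op i (flux i j).
Proof.
have dr := opsqrt_differentiable i hnu.
have dg := smooth_differentiable i (gS i j).
have dw := smooth_differentiable i (coefS j).
by case: (derivationM (derivationM (derivationM dr dg).1 dr).1 dw).
Qed.

Lemma adj_flux i j : adj (flux i j) = adj (coef w j) \o r \o g j i \o r.
Proof.
have gr := opsqrt_adjointable hnu; have gg := smooth_adjointable (gS i j).
have gw := smooth_adjointable (coefS j).
have grg := adjointableM gr gg; have grgr := adjointableM grg gr.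
by rewrite /flux (adjM grgr gw) (adjM grg gr) (adjM gr gg) (opsqrt_adj hnu) (adj_opmxinv hh).
Qed.

Lemma adj_nu : adj nu = nu.
Proof. by case: hnu => _ /positive_adj. Qed.

Lemma adj_opinv_nu : adj (opinv nu) = opinv nu.
Proof.
have [inu snu] := opinvP hnu; have gi := smooth_adjointable snu.
have gn : adjointable nu by case: hnu => /smooth_adjointable.
apply/esym/opinvE; case: inu => h1 h2; split.
  by rewrite -[X in X \o _]adj_nu -adjM// h2; apply: adjE; exact: is_adjoint_idfun.
by rewrite -[X in _ \o X]adj_nu -adjM// h1; apply: adjE; exact: is_adjoint_idfun.
Qed.

(** Taking adjoints reverses products, commutes with the derivations and fixes
    the inverse of nu. *)
Lemma delta_div (X : 'I_n -> op) :
  (forall i, X i \o nu = \sum_j adj (flux i j)) -> delta theta h nu w = adj (div nu X).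
Proof.
move=> XE; have [_ /smooth_adjointable gi] := opinvP hnu.
have gd i j : adjointable (derivation i (flux i j)) by have [] := flux_differentiable i j.
have dX i : derivation i (X i \o nu) = \sum_j adj (derivation i (flux i j)).
  rewrite XE derivation_sum => [|j _]; last by have [] := derivation_adj (flux_differentiable i j).
  by apply: eq_bigr => j _; have [] := derivation_adj (flux_differentiable i j).
have gs i : adjointable (\sum_j adj (derivation i (flux i j))).
  by apply: adjointable_sum => j _; exact: adjointable_adj.
rewrite /div adj_sum => [|i _]; last by rewrite dX; exact: adjointableM.
apply/funext => u; rewrite op_sumE /delta /= op_sumE (lin_sum (adjointable_lin gi)).
apply: eq_bigr => i _; rewrite dX adjM// adj_opinv_nu /= adj_sum => [|j _]; last exact: adjointable_adj.
by congr (opinv nu _); rewrite !op_sumE; apply: eq_bigr => j _; rewrite adjK.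
Qed.

Lemma opinv_opsqrt u : opinv r (nu u) = r u.
Proof.
have [[h1 h2] _] := opinvP hnu; have rr := opsqrt_sqr hnu.
have K x : opinv nu (r (r x)) = x by rewrite rr -[LHS]/((opinv nu \o nu) x) h2.
have K' x : r (r (opinv nu x)) = x by rewrite rr -[LHS]/((nu \o opinv nu) x) h1.
suff -> : opinv r = opinv nu \o r by rewrite /= -rr K.
apply: opinvE; split; apply/funext => x /=; last exact: K.
by rewrite -[in RHS](K' x) -[in RHS](K (r (opinv nu x))) -{1}[x]K' K K'.
Qed.

(** The factor nu of the inner product cancels the inverse of nu in [delta], and
    the derivations then move to the adjoint of u under the trace. *)
Lemma integration_by_parts u : smooth_nct theta u ->
  inner_nu nu (- delta theta h nu w) u = inner_form theta h nu w (d u).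
Proof.
move=> su; have [[nK _] _] := opinvP hnu.
have gn : adjointable nu by case: hnu => /smooth_adjointable.
have gu := smooth_adjointable su; have lau := adjointable_lin (adjointable_adj gu).
rewrite /inner_nu.
have -> : adj u \o nu \o - delta theta h nu w =
    - \sum_i \sum_j (adj u \o derivation i (flux i j)).
  apply/funext => v.
  rewrite -[LHS](_ : adj u (nu (- (delta theta h nu w v))) = _)//.
  rewrite (linN (adjointable_lin gn)) (linN lau) /delta.
  rewrite -[X in adj u X]/((nu \o opinv nu) _) nK.
  rewrite -[RHS]/(- ((\sum_i \sum_j (adj u \o derivation i (flux i j))) v)); congr (- _).
  rewrite !op_sumE (lin_sum lau); apply: eq_bigr => i _.
  by rewrite !op_sumE (lin_sum lau); apply: eq_bigr => j _.
rewrite tauN tau_sum -sumrN; apply: eq_bigr => i _.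
rewrite tau_sum -sumrN; apply: eq_bigr => j _.
have [dau eau] := derivation_adj (smooth_differentiable i su).
by rewrite (tau_by_parts dau (flux_differentiable i j)) opprK eau coef_d.
Qed.

Lemma delta_form_vf_nu : delta theta h nu w = adj (div nu (form_vf_nu theta h nu w)).
Proof.
apply: delta_div => i; apply/funext => u; rewrite /= /form_vf_nu !op_sumE.
by apply: eq_bigr => j _; rewrite adj_flux /= opinv_opsqrt.
Qed.

Lemma delta_form_vf : (forall i j, nu \o h i j = h i j \o nu) ->
  delta theta h nu w = adj (div nu (form_vf theta h w)).
Proof.
move=> c; have gn : adjointable nu by case: hnu => /smooth_adjointable.
apply: delta_div => i; apply/funext => u.
rewrite /= (form_vfE (nctorus_idfun hnu) hh fw) !op_sumE; apply: eq_bigr => j _.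
rewrite adj_flux /= (commute_opsqrt hnu (opmxinv_adjointable hh j i)) ?(opsqrt_sqr hnu)//.
exact: (commute_opmxinv hh gn c).
Qed.

End Divergence.

Theorem proposition8p12 (R : realType) (n : nat) (hn : (2 <= n)%N)
    (theta : 'M[R]_n) (htheta : theta^T = - theta)
    (h : 'M[L2op R n]_n) (hh : GLplus theta h)
    (nu : L2op R n) (hnu : smooth_pos_inv theta nu) :
  [/\ forall w u, form1 theta w -> smooth_nct theta u ->
        inner_nu nu (- delta theta h nu w) u = inner_form theta h nu w (d u),
      forall w, form1 theta w ->
        delta theta h nu w = adj (div nu (form_vf_nu theta h nu w)) &
      (forall i j, nu \o h i j = h i j \o nu) ->
        forall w, form1 theta w ->
        delta theta h nu w = adj (div nu (form_vf theta h w))].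
Proof.
split=> [w u fw su|w fw|c w fw].
- exact: integration_by_parts.
- exact: delta_form_vf_nu.
- exact: delta_form_vf.
Qed.
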